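(* Let $F^\gamma:\mathbb{R}^M\to\mathbb{R}^M$, $\sigma^\gamma:\mathbb{R}^M\to\mathbb{R}$ ($\gamma\in I$), $\Phi:\mathbb{R}^M\to\mathbb{R}$ and the scalar process $(\alpha_t)_{t\in[0,T]}$ (adapted and independent of $\gamma$) satisfy the standing assumptions (A1)--(A5) listed in the context. Let $N\ge1$, $\Delta t=T/N$, $\alpha_n:=\alpha_{n\Delta t}$, and $\Delta B_n:=B_{(n+1)\Delta t}-B_{n\Delta t}$. Fix $x_0,v_0\in\mathbb{R}^M$, and for $\gamma\in I$ define $X^\gamma_0=x_0+\gamma v_0$ and $$X^\gamma_{n+1}=X^\gamma_n+F^\gamma(X^\gamma_n)\Delta t+\sigma^\gamma(X^\gamma_n)\Delta B_n,\qquad 0\le n\le N-1 .$$ Write $X_n=X_n^{\gamma=0}$, $F=F^0$, $\sigma=\sigma^0$, and define $v_n$, starting from $v_0$, by $$v_{n+1}=v_n-\alpha_nv_n\Delta t+\big(\nabla_{v_n}F(X_n)+\delta F^\gamma(X_n)\big)\Delta t+\big(\nabla_{v_n}\sigma(X_n)+\delta\sigma^\gamma(X_n)\big)\Delta B_n .$$ Then the derivative $\delta\,\mathbb{E}[\Phi(X^\gamma_N)]=\frac{\partial}{\partial\gamma}\big|_{\gamma=0}\mathbb{E}[\Phi(X^\gamma_N)]$ exists and $$\delta\,\mathbb{E}\big[\Phi(X^\gamma_N)\big]=\mathbb{E}\left[\nabla\Phi(X_N)\cdot v_N+\Phi(X_N)\sum_{n=0}^{N-1}\frac{\Delta B_n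}{\sigma(X_n)}\cdot\alpha_nv_n\right].$$
   Context: Notation. $T>0$ is fixed; $B$ is a standard Brownian motion in $\mathbb{R}^M$; $\mathcal{F}_t$ is the $\sigma$-algebra generated by $\{B_\tau\}_{\tau\le t}$ and $X_0$ (deterministic here). The parameter $\gamma$ ranges over an interval $I=[\gamma_{\min},\gamma_{\max}]$ around $0$; omitting $\gamma$ means $\gamma=0$. $\delta(\cdot):=\partial(\cdot)/\partial\gamma|_{\gamma=0}$, so $\delta F^\gamma(X_n)$ in the recursion for $v$ is the partial derivative in $\gamma$ at $\gamma=0$ with the spatial argument held fixed, evaluated at $X_n$ (and likewise for $\sigma$); in the assumptions below, $\delta F^\gamma(x)$ and $\delta\sigma^\gamma(x)$ denote the partial derivatives in $\gamma$ at an arbitrary $\gamma\in I$. $\nabla$ is the spatial derivative: $\nabla_vF(x)=\frac{\partial F}{\partial x}(x)\,v\in\mathbb{R}^M$ and $\nabla_v\sigma(x)=\nabla\sigma(x)\cdot v\in\mathbb{R}$. Standing assumptions. There exist constants $L,K,\sigma^*,\alpha^*,L',C>0$ such that the partial derivatives $\nabla F,\nabla\sigma,\delta F,\delta\sigma,\nabla\Phi$ exist, and for all $\gamma\in I$, $t,s\in[0,T]$, $x,y\in\mathbb{R}^M$: (A1) $|F^\gamma(x)-F^\gamma(y)|$, $|\sigma^\gamma(x)-\sigma^\gamma(y)|$, $|\delta F^\gamma(x)-\delta F^\gamma(y)|$, $|\delta\sigma^\gamma(x)-\delta\sigma^\gamma(y)|$ are all $\le L|x-y|$. (A2) $|F^\gamma(x)|^2$,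 $|\sigma^\gamma(x)|^2$, $|\delta F^\gamma(x)|^2$, $|\delta\sigma^\gamma(x)|^2$ are all $\le K(1+|x|^2)$. (A3) $\alpha$ is a scalar $\mathcal{F}_t$-adapted process with almost surely bounded and Lipschitz paths: $|\alpha_t|\le\alpha^*$ and $|\alpha_t-\alpha_s|\le C|t-s|$. (A4) $|\sigma^\gamma(x)|\ge\sigma^*>0$. (A5) $|\Phi(x)-\Phi(y)|$ and $|\nabla\Phi(x)-\nabla\Phi(y)|$ are both $\le L'|x-y|$. *)

(* Defs.v *)
From HB Require Import structures.
From mathcomp Require Import all_boot all_order all_algebra.
From mathcomp Require Import all_classical all_reals all_analysis.

Set Implicit Arguments.
Unset Strict Implicit.
Unset Printing Implicit Defensive.

Import Order.TTheory GRing.Theory Num.Theory.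
Import numFieldNormedType.Exports.

Local Open Scope classical_set_scope.
Local Open Scope ring_scope.

(* Points of R^M are row vectors. The library norm `|x| on 'rV[R]_M is the
   sup norm (same topology, same notion of differentiability), so the
   Euclidean norm is introduced separately. *)
Definition dotp (R : realType) (M : nat) (u v : 'rV[R]_M) : R :=
  \sum_(i < M) u 0 i * v 0 i.

Definition enorm (R : realType) (M : nat) (u : 'rV[R]_M) : R :=
  Num.sqrt (dotp u u).

Definition grad (R : realType) (M : nat) (f : 'rV[R]_M -> R^o)
    (x : 'rV[R]_M) : 'rV[R]_M :=
  \row_(i < M) 'D_('e_i) f x.

(* [f] has derivative [l] at [x] relative to [I]; this is the one-sided
   derivative when [x] is an endpoint of an interval [I]. *)
Definition has_derivative_on (R : realType) (V : normedModType R)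
    (I : set R) (f : R -> V) (x : R) (l : V) : Prop :=
  h^-1 *: (f (x + h) - f x) @[h --> within [set h | I (x + h)] 0^'] --> l.

(* The Borel sigma-algebra of R^M is generated by the coordinates, so this is
   the sigma-algebra generated by the random vector [X]. *)
Definition sigma_rvec (R : realType) (Omega : Type) (M : nat)
    (X : Omega -> 'rV[R]_M) : set (set Omega) :=
  <<s \bigcup_(i : 'I_M) preimage_set_system setT (fun w => X w 0 i)
        (@measurable _ (measurableTypeR R)) >>.

Definition natural_filtration (R : realType) (Omega : Type) (M : nat)
    (B : R -> Omega -> 'rV[R]_M) (t : R) : set (set Omega) :=
  <<s \bigcup_(tau in `[0, t]) sigma_rvec (B tau) >>.

Definition adapted_on (R : realType) (Omega : Type) (T : R)
    (Ft : R -> set (set Omega)) (alpha : R -> Omega -> R) : Prop :=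
  forall t : R, t \in `[0, T] ->
    preimage_set_system setT (alpha t) (@measurable _ (measurableTypeR R))
      `<=` Ft t.

(* Standard Brownian motion in R^M, indexed by t >= 0 (values at negative
   times are irrelevant). [normal_prob m s] is parametrized by the standard
   deviation [s]. *)
Record standard_brownian_motion (R : realType) (d : measure_display)
    (Omega : measurableType d) (P : probability Omega R) (M : nat)
    (B : R -> Omega -> 'rV[R]_M) : Prop := StandardBrownianMotion {
  bm_measurable : forall (t : R) (i : 'I_M), 0 <= t ->
    measurable_fun setT (fun w => B t w 0 i : measurableTypeR R);
  bm_start : {ae P, forall w, B 0 w = 0};
  bm_independent : forall s t : R, 0 <= s < t -> forall A E,
    natural_filtration B s A -> sigma_rvec (fun w => B t w - B s w) E ->
    P (A `&` E) = (P A * P E)%E;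
  bm_gaussian : forall s t : R, 0 <= s < t ->
    forall U : 'I_M -> set R,
    (forall i, measurable (U i : set (measurableTypeR R))) ->
    P [set w | forall i, U i ((B t w - B s w) 0 i)] =
      (\prod_(i < M) normal_prob 0 (Num.sqrt (t - s)) (U i))%E;
  bm_continuous :
    {ae P, forall w, {within `[0, +oo[, continuous (fun t => B t w)}}
}.

Definition increment (R : realType) (Omega : Type) (M : nat)
    (B : R -> Omega -> 'rV[R]_M) (dt : R) (n : nat) (w : Omega) : 'rV[R]_M :=
  B (n.+1%:R * dt) w - B (n%:R * dt) w.

Fixpoint euler (R : realType) (Omega : Type) (M : nat)
    (F : R -> 'rV[R]_M -> 'rV[R]_M) (sigma : R -> 'rV[R]_M -> R^o)
    (B : R -> Omega -> 'rV[R]_M) (x0 v0 : 'rV[R]_M) (dt : R)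
    (gamma : R) (n : nat) (w : Omega) : 'rV[R]_M :=
  if n is k.+1 then
    let x := euler F sigma B x0 v0 dt gamma k w in
    x + dt *: F gamma x + sigma gamma x *: increment B dt k w
  else x0 + gamma *: v0.

(* [dF] and [dsigma] stand for the partial derivatives of [F] and [sigma] in
   the parameter; ['d f x v] is the Frechet derivative applied to [v]. *)
Fixpoint tangent (R : realType) (Omega : Type) (M : nat)
    (F dF : R -> 'rV[R]_M -> 'rV[R]_M) (sigma dsigma : R -> 'rV[R]_M -> R^o)
    (alpha : R -> Omega -> R)
    (B : R -> Omega -> 'rV[R]_M) (x0 v0 : 'rV[R]_M) (dt : R)
    (n : nat) (w : Omega) : 'rV[R]_M :=
  if n is k.+1 then
    let x := euler F sigma B x0 v0 dt 0 k w in
    let v := tangent F dF sigma dsigma alpha B x0 v0 dt k w in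
    v - (alpha (k%:R * dt) w * dt) *: v
      + dt *: ('d (F 0) x v + dF 0 x)
      + (dotp (grad (sigma 0) x) v + dsigma 0 x) *: increment B dt k w
  else v0.

(* Main.v *)
Require Import Defs.
From HB Require Import structures.
From mathcomp Require Import all_boot all_order all_algebra.
From mathcomp Require Import all_classical all_reals all_analysis.
From mathcomp Require Import measurable_realfun.
From mathcomp Require Import ring lra.

Set Implicit Arguments.
Unset Strict Implicit.
Unset Printing Implicit Defensive.

Import Order.TTheory GRing.Theory Num.Theory.
Import numFieldNormedType.Exports.

Local Open Scope classical_set_scope.
Local Open Scope ring_scope.

(** [alpha] is adapted to the whole Brownian filtration, so [alpha_n] may depend on the path between
    grid points and the expectation is not a finite-dimensional Gaussian integral. The integration
    by parts is therefore carried out on [Omega] itself: equipped with the sigma-algebra of all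
    noise except one coordinate, it is one factor of a product space whose other factor is the real
    line with a centered normal law. Shifting that coordinate moves only [X_N]: the scheme [X] does
    not involve [alpha], and [G_(n,i)] is already known at time [n dt]. The division by [sigma(X_n)]
    in [G_(n,i)] is what reproduces the source: moving the [n]-th increment along the [i]-th basis
    vector moves [X_(n+1)] by [sigma(X_n)] times that vector, so the weighted moves add up to
    [alpha_n v_n dt]. The bound on [alpha] holds only almost surely; pathwise estimates are
    therefore relative to a set [A] of full probability. *)

(** Differentiating pathwise under the expectation gives
    [d/dg E[Phi(X^g_N)] = E[grad Phi(X_N) . u_N]], where [u] is the tangent process
    without damping. The difference [u - v] solves the same linear recursion with
    source [alpha_n v_n dt]; hence [u_N - v_N] is the sum over [n] and [i] of
    [G_(n,i) D_(n,i)], where [D_(n,i)] is the derivative of [X_N] with respect to the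
    [i]-th coordinate of the [n]-th increment and
    [G_(n,i) = alpha_n dt (v_n)_i / sigma(X_n)]. That coordinate is a centered Gaussian
    of variance [dt], independent of all the other noise and of [G_(n,i)], so that
    Gaussian integration by parts turns [E[G_(n,i) grad Phi(X_N) . D_(n,i)]] into
    [E[Phi(X_N) G_(n,i) (Delta B_n)_i] / dt]. The integration by parts is the derivative
    at zero shift of the Cameron-Martin formula in one coordinate, which needs no
    continuity of the derivatives of the coefficients. Every domination is by the
    exponential of a multiple of the sum of the absolute values of the coordinates of
    the increments. *)

(** * Row vectors and derivatives of curves *)

Section row_norms.
Context {R : realType} {M : nat}.
Implicit Types u v : 'rV[R]_M.

Lemma rV_normr_coord u i : `|u 0 i| <= `|u|.
Proof.
rewrite [leRHS]/Num.norm /= mx_normrE; apply/bigmax_geP; right => /=.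
by exists (0, i).
Qed.

Lemma rV_normr_le u (c : R) : 0 <= c -> (forall i, `|u 0 i| <= c) -> `|u| <= c.
Proof.
move=> c0 uc; rewrite [leLHS]/Num.norm /= mx_normrE; apply/bigmax_leP; split => //.
by case=> i j _ /=; rewrite ord1.
Qed.

Lemma dotpC u v : dotp u v = dotp v u.
Proof. by apply: eq_bigr => i _; rewrite mulrC. Qed.

Lemma dotpZr u v (a : R) : dotp u (a *: v) = a * dotp u v.
Proof.
by rewrite big_distrr /=; apply: eq_bigr => i _; rewrite mxE mulrCA.
Qed.

Lemma dotpZl u v (a : R) : dotp (a *: u) v = a * dotp u v.
Proof. by rewrite dotpC dotpZr dotpC. Qed.

Lemma normr_dotp_le u v : `|dotp u v| <= M%:R * (`|u| * `|v|).
Proof.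
apply: le_trans (ler_norm_sum _ _ _) _.
rewrite [leRHS](_ : _ = \sum_(i < M) `|u| * `|v|); last first.
  by rewrite sumr_const card_ord mulr_natl.
apply: ler_sum => i _.
by rewrite normrM ler_pM ?rV_normr_coord.
Qed.

Lemma enorm_ge0 u : 0 <= enorm u. Proof. exact: sqrtr_ge0. Qed.

Lemma rV_normr_enorm u : `|u| <= enorm u.
Proof.
apply: rV_normr_le => [|i]; first exact: enorm_ge0.
rewrite -sqrtr_sqr ler_sqrt; last by apply: sumr_ge0 => j _; rewrite -expr2 sqr_ge0.
rewrite /dotp (bigD1 i) //= expr2 lerDl.
by apply: sumr_ge0 => j _; rewrite -expr2 sqr_ge0.
Qed.

Lemma enorm_le u : enorm u <= M%:R * `|u|.
Proof.
rewrite -[leRHS]ger0_norm ?mulr_ge0// -sqrtr_sqr ler_sqrt ?sqr_ge0//.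
apply: le_trans (ler_norm _) _; apply: le_trans (normr_dotp_le _ _) _.
rewrite exprMn !expr2 ler_wpM2r// ?mulr_ge0//.
case: M => [|m]; first by rewrite mul0r.
by rewrite ler_peMl// ler1n.
Qed.

Lemma rV_delta_sum u : u = \sum_(i < M) u 0 i *: 'e_i.
Proof. exact: row_sum_delta. Qed.

Lemma diff_gradE (f : 'rV[R]_M -> R^o) x v :
  differentiable f x -> 'd f x v = dotp (grad f x) v.
Proof.
move=> df; rewrite {1}(rV_delta_sum v) linear_sum /=; apply: eq_bigr => i _.
by rewrite linearZ /= mxE deriveE// mulrC.
Qed.

End row_norms.

Lemma near_cvg {T : Type} {U : topologicalType} {F : set_system T} {FF : Filter F}
    (f g : T -> U) (l : U) :
  {near F, f =1 g} -> f x @[x --> F] --> l -> g x @[x --> F] --> l.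
Proof. by move=> fg; apply: cvg_trans; exact: near_eq_cvg. Qed.

Lemma dnbhs0_cvg0 {R : realType} : (h : R) @[h --> 0^'] --> (0 : R).
Proof. by move=> A A0; exact: (@cvg_within _ (nbhs (0 : R))). Qed.

(** The base point is a separate argument rather than [x 0]: the limit ignores the value of the
    curve at 0, and base points are often available only in another form. *)
Definition curve_deriv {R : realType} {V : normedModType R}
    (x : R -> V) (x0 u : V) : Prop :=
  h^-1 *: (x h - x0) @[h --> 0^'] --> u.

Section curve_deriv_lemmas.
Context {R : realType}.
Implicit Types V W : normedModType R.

Lemma curve_deriv_cst V (x0 : V) : curve_deriv (fun=> x0) x0 0.
Proof.
rewrite /curve_deriv; under eq_fun do rewrite subrr scaler0.
exact: cvg_cst.
Qed.

Lemma curve_deriv_line V (x0 u : V) : curve_deriv (fun h => x0 + h *: u) x0 u.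
Proof.
apply: (near_cvg (f := fun=> u)); last exact: cvg_cst.
near=> h.
rewrite addrC addrA addNr add0r scalerA mulVf ?scale1r//.
by near: h; exact: nbhs_dnbhs_neq.
Unshelve. all: end_near. Qed.

Lemma curve_derivD V (x y : R -> V) x0 y0 u v :
  curve_deriv x x0 u -> curve_deriv y y0 v ->
  curve_deriv (fun h => x h + y h) (x0 + y0) (u + v).
Proof.
move=> xu yv; apply: near_cvg (cvgD xu yv).
by apply: nearW => h /=; rewrite -scalerDr opprD addrACA.
Qed.

Lemma curve_derivZ V (x : R -> V) x0 u (a : R) :
  curve_deriv x x0 u -> curve_deriv (fun h => a *: x h) (a *: x0) (a *: u).
Proof.
move=> xu; apply: near_cvg (@cvgZl_tmp _ _ _ _ _ a _ _ xu).
by apply: nearW => h /=; rewrite -scalerBr !scalerA mulrC.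
Qed.

Lemma curve_deriv_cvg V (x : R -> V) x0 u :
  curve_deriv x x0 u -> x h @[h --> 0^'] --> x0.
Proof.
move=> xu; apply/subr_cvg0; have h1 : h *: (h^-1 *: (x h - x0)) @[h --> 0^'] --> (0 : V).
  by rewrite -(scale0r u); exact: cvgZ dnbhs0_cvg0 xu.
apply: near_cvg h1; near=> h; rewrite scalerA mulfV ?scale1r//.
by near: h; exact: nbhs_dnbhs_neq.
Unshelve. all: end_near. Qed.

Lemma curve_deriv_scale V (a : R -> R^o) (a0 b : R^o) (x : R -> V) x0 u :
  curve_deriv a a0 b -> curve_deriv x x0 u ->
  curve_deriv (fun h => a h *: x h) (a0 *: x0) (a0 *: u + b *: x0).
Proof.
move=> ab xu.
apply: near_cvg (cvgD (cvgZ (curve_deriv_cvg ab) xu) (cvgZr_tmp ab)).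
apply: nearW => h /=.
rewrite scalerA mulrC -!scalerA -scalerDr; congr (_ *: _).
by rewrite scalerBr scalerBl addrA subrK.
Qed.

Lemma curve_deriv_comp V W (f : V -> W) (x : R -> V) x0 u :
  differentiable f x0 -> curve_deriv x x0 u ->
  curve_deriv (fun h => f (x h)) (f x0) ('d f x0 u).
Proof.
(* [x 0] need not be [x0], so the curve is corrected at 0 before the chain rule for differentiable
   maps is applied. *)
move=> df xu; pose y (h : R) := if h == 0 then x0 else x h.
have y0 : y 0 = x0 by rewrite /y eqxx.
have yu : h^-1 *: (y (h *: (1 : R) + 0) - y 0) @[h --> 0^'] --> u.
  apply: near_cvg xu; near=> h.
  have h0 : h != 0 by near: h; exact: nbhs_dnbhs_neq.
  by rewrite y0 addr0 [h *: 1]mulr1 /y (negbTE h0).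
have dy : derivable y 0 1 by apply/cvg_ex; exists u.
have Dy : 'D_1 y 0 = u by apply/cvg_lim.
have dyD : differentiable y 0 by exact/derivable1_diffP.
have dfD : differentiable f (y 0) by rewrite y0.
have dfyD := differentiable_comp dyD dfD.
have dfy : derivable (f \o y) 0 1 by exact/derivable1_diffP.
have <- : 'D_1 (f \o y) 0 = 'd f x0 u.
  have <- : 'd y 0 1 = u by rewrite -deriveE.
  by rewrite deriveE// diff_comp//= y0.
have h1 : h^-1 *: ((f \o y) (h *: (1 : R) + 0) - (f \o y) 0) @[h --> 0^'] -->
   'D_1 (f \o y) 0 by exact: dfy.
apply: near_cvg h1; near=> h.
have h0 : h != 0 by near: h; exact: nbhs_dnbhs_neq.
by rewrite /= y0 addr0 [h *: 1]mulr1 /y (negbTE h0).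
Unshelve. all: end_near. Qed.

Lemma curve_deriv_small V (x : R -> V) (y : R -> R) (C r : R) :
  0 < r -> (forall h, `|h| < r -> `|x h| <= `|h| * (C * y h)) ->
  y h @[h --> 0^'] --> 0 -> curve_deriv x 0 0.
Proof.
move=> r0 xy yu.
have Cy : C * y h @[h --> 0^'] --> C * 0 by apply: cvgM yu; exact: cvg_cst.
rewrite mulr0 in Cy.
have h1 : `|h^-1 *: (x h - 0)| @[h --> 0^'] --> (0 : R).
  apply: squeeze_cvgr Cy; last first.
    exact: (@cvg_cst R).
  near=> h; rewrite normr_ge0 /= subr0 normrZ normfV ler_pdivrMl.
    apply: xy; near: h; exact: dnbhs0_lt.
  by rewrite normr_gt0; near: h; exact: nbhs_dnbhs_neq.
exact: norm_cvg0 h1.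
Unshelve. all: end_near. Qed.

End curve_deriv_lemmas.

Arguments curve_deriv_cst {R V} x0 [t] _.
Arguments curve_deriv_line {R V} x0 u [t] _.

(** * Parametrized coefficients and Euler schemes *)

Lemma lipschitz_growth {R : realType} {V W : normedModType R} (f : V -> W) (L : R) :
  (forall x y, `|f x - f y| <= L * `|x - y|) -> forall x, `|f x| <= `|f 0| + L * `|x|.
Proof.
move=> fL x; rewrite -[f x](subrK (f 0)) addrC; apply: le_trans (ler_normD _ _) _.
by rewrite lerD2l; have := fL x 0; rewrite subr0.
Qed.

Lemma lipschitz_continuous {R : realType} {V W : normedModType R} (f : V -> W) (L : R) :
  0 <= L -> (forall x y, `|f x - f y| <= L * `|x - y|) -> continuous f.
Proof.
move=> L0 fL x; have L1 : 0 < L + 1 by lra.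
apply/cvgrPdist_le => e e0; near=> y.
apply: le_trans (fL x y) _.
apply: (@le_trans _ _ ((L + 1) * `|x - y|)); first by apply: ler_wpM2r => //; lra.
rewrite -ler_pdivlMl//; near: y.
apply: (@cvgr_dist_le _ _ _ (nbhs x) _ idfun x cvg_id).
by rewrite mulr_gt0// invr_gt0.
Unshelve. all: end_near. Qed.

(* [family_incr_lip], a Lipschitz bound on the increments [f h - f 0], makes
   the chain rule hold along curves without joint differentiability in [(h, x)]. *)
Record smooth_family {R : realType} {M : nat} {V : normedModType R}
    (f : R -> 'rV[R]_M -> V) (df : 'rV[R]_M -> V) (r L : R) : Prop := SmoothFamily {
  family_lip : forall h x y, `|h| < r -> `|f h x - f h y| <= L * `|x - y|;
  family_incr_lip : forall h x y, `|h| < r ->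
    `|(f h x - f 0 x) - (f h y - f 0 y)| <= `|h| * (L * `|x - y|);
  family_incr : forall h x, `|h| < r -> `|f h x - f 0 x| <= `|h| * (L * (1 + `|x|));
  family_deriv : forall x, curve_deriv (f ^~ x) (f 0 x) (df x);
  family_diff : forall x, differentiable (f 0) x
}.

Section smooth_family_lemmas.
Context {R : realType} {M : nat} {V : normedModType R}.
Variables (f : R -> 'rV[R]_M -> V) (df : 'rV[R]_M -> V) (r L : R).
Hypotheses (r0 : 0 < r) (L0 : 0 <= L) (ff : smooth_family f df r L).

Lemma family_curve_deriv (x : R -> 'rV[R]_M) (x0 u : 'rV[R]_M) : curve_deriv x x0 u ->
  curve_deriv (fun h => f h (x h)) (f 0 x0) ('d (f 0) x0 u + df x0).
Proof.
move=> xu.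
have h1 := curve_deriv_comp (family_diff ff x0) xu.
have h2 : curve_deriv (f ^~ x0) (f 0 x0) (df x0) := @family_deriv _ _ _ _ _ _ _ ff x0.
(* [f h (x h)] is [f 0 (x h)] plus the change of [f] at the fixed point [x0] plus this mixed
   increment, which is at most [L * |x h - x0|] times [|h|], hence negligible. *)
have h3 : curve_deriv
    (fun h => (f h (x h) - f 0 (x h)) - (f h x0 - f 0 x0)) 0 0.
  apply: (@curve_deriv_small _ _ _ (fun h => `|x h - x0|) L r r0).
    by move=> h hr; exact (family_incr_lip ff (x h) x0 hr).
  have xx0 : x h - x0 @[h --> 0^'] --> (0 : 'rV[R]_M).
    by apply/subr_cvg0; exact: curve_deriv_cvg xu.
  have nx : `|x h - x0| @[h --> 0^'] --> `|0 : 'rV[R]_M| by apply: cvg_norm.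
  by rewrite normr0 in nx.
have := curve_derivD (curve_derivD (curve_derivD h1 h2) h3) (curve_deriv_cst (- f 0 x0)).
rewrite !addr0 addrK; apply: near_cvg; apply: nearW => h /=.
have aux (a b c d : V) : a + b + (c - a - (b - d)) - d = c.
  by rewrite opprB addrACA (addrC a) subrK (addrC b) subrK addrK.
by rewrite aux.
Qed.

Lemma family_bound0 (x : 'rV[R]_M) : `|f 0 x| <= `|f 0 0| + L * `|x|.
Proof.
by apply: lipschitz_growth => y z; apply: (family_lip ff); rewrite normr0.
Qed.

Lemma family_diff_le h (x y : 'rV[R]_M) : `|h| < r ->
  `|f h y - f 0 x| <= L * `|y - x| + `|h| * (L * (1 + `|x|)).
Proof.
move=> hr; rewrite -[f h y](subrK (f h x)) -addrA.
apply: le_trans (ler_normD _ _) _; apply: lerD; first exact (family_lip ff _ _ hr).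
exact (family_incr ff _ hr).
Qed.

Lemma family_derive_le (x u : 'rV[R]_M) : `|'d (f 0) x u| <= L * `|u|.
Proof.
have h1 := curve_deriv_comp (family_diff ff x) (curve_deriv_line x u).
apply: (cvgr_to_le (cvg_norm h1)); near=> h.
have h0 : h != 0 by near: h; exact: nbhs_dnbhs_neq.
rewrite normrZ normfV ler_pdivrMl ?normr_gt0//.
have h0r : `|0 : R| < r by rewrite normr0.
apply: (le_trans (family_lip ff (x + h *: u) x h0r)).
by rewrite addrC addKr normrZ mulrCA.
Unshelve. all: end_near. Qed.

End smooth_family_lemmas.

Section euler_maps.
Context {R : realType} {M : nat}.
Implicit Types (f : 'rV[R]_M -> 'rV[R]_M) (s : 'rV[R]_M -> R^o) (xi : nat -> 'rV[R]_M).

(** A deterministic function of the noise sequence, so that the noise can be shifted path by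
    path. *)
Fixpoint euler_map f s (dt : R) xi (x0 : 'rV[R]_M) (n : nat) : 'rV[R]_M :=
  if n is k.+1 then
    let x := euler_map f s dt xi x0 k in
    x + dt *: f x + s x *: xi k
  else x0.

(** Derivative of the scheme when the start moves along [u0], the noise along [eta] and the
    coefficients along [df] and [ds]. Two cases occur: [eta = 0] is the derivative in the parameter,
    and [u0 = 0], [df = ds = 0] with a basis vector in [eta] is the derivative in one noise
    coordinate. *)
Fixpoint tangent_map f df s ds (dt : R) xi eta (x0 u0 : 'rV[R]_M) (n : nat) :
    'rV[R]_M :=
  if n is k.+1 then
    let x := euler_map f s dt xi x0 k in
    let u := tangent_map f df s ds dt xi eta x0 u0 k in
    u + dt *: ('d f x u + df x) + ((s x *: eta k) + (('d s x u + ds x : R^o) *: xi k))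
  else u0.

End euler_maps.

Section perturbation.
Context {R : realType} {M : nat}.
Variables (f : R -> 'rV[R]_M -> 'rV[R]_M) (df : 'rV[R]_M -> 'rV[R]_M).
Variables (s : R -> 'rV[R]_M -> R^o) (ds : 'rV[R]_M -> R^o).
Variables (r L : R) (r0 : 0 < r) (L0 : 0 <= L).
Hypotheses (ff : smooth_family f df r L) (fs : smooth_family s ds r L).
Variables (dt : R) (x0 u0 : 'rV[R]_M) (eta : nat -> 'rV[R]_M).

Lemma euler_map_curve_deriv xi n :
  curve_deriv
    (fun h => euler_map (f h) (s h) dt (fun k => xi k + h *: eta k) (x0 + h *: u0) n)
    (euler_map (f 0) (s 0) dt xi x0 n)
    (tangent_map (f 0) df (s 0) ds dt xi eta x0 u0 n).
Proof.
elim: n => [|n IH] /=; first exact: curve_deriv_line.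
apply: curve_derivD.
  by apply: curve_derivD => //; apply: curve_derivZ; exact (family_curve_deriv r0 ff IH).
apply: curve_deriv_scale; last exact: curve_deriv_line.
exact (family_curve_deriv r0 fs IH).
Qed.

End perturbation.

(** * Domination by exponentials of the noise *)

(* The summand [1] absorbs constant factors, so that this class is an algebra. *)
Definition exp_bounded {R : realType} {T : Type} (A : set T) (S : T -> R)
    (f : T -> R) : Prop :=
  exists2 c, 0 <= c & forall w, A w -> `|f w| <= expR (c * (1 + S w)).

Section exp_bounded_lemmas.
Context {R : realType} {T : Type}.
Variables (A : set T) (S : T -> R).
Hypothesis S0 : forall w, 0 <= S w.
Implicit Types f g : T -> R.

Lemma exp_bounded_le f g : exp_bounded A S g ->
  (forall w, A w -> `|f w| <= `|g w|) -> exp_bounded A S f.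
Proof. by move=> [c c0 gc] fg; exists c => // w Aw; exact: le_trans (fg _ Aw) (gc _ Aw). Qed.

Lemma exp_bounded_cst (a : R) : exp_bounded A S (fun=> a).
Proof.
exists `|a| => // w _.
apply: le_trans (ler_wpDl ler01 (lexx `|a|)) _.
apply: le_trans (expR_ge1Dx _) _; rewrite ler_expR ler_peMr//.
by rewrite lerDl.
Qed.

Lemma exp_boundedM f g : exp_bounded A S f -> exp_bounded A S g ->
  exp_bounded A S (fun w => f w * g w).
Proof.
move=> [c c0 fc] [e e0 ge]; exists (c + e); first exact: addr_ge0.
by move=> w Aw; rewrite normrM mulrDl expRD ler_pM// ?fc ?ge.
Qed.

Lemma exp_boundedD f g : exp_bounded A S f -> exp_bounded A S g ->
  exp_bounded A S (fun w => f w + g w).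
Proof.
(* The sum is at most [2 * expR ((c + e) * (1 + S w))], and [2 <= expR 1] costs one more unit in the
   exponent. *)
move=> [c c0 fc] [e e0 ge]; exists (1 + (c + e)); first by rewrite !addr_ge0.
move=> w Aw; apply: le_trans (ler_normD _ _) _.
have s1 : 1 <= 1 + S w by rewrite lerDl.
have s0 : 0 <= 1 + S w by apply: le_trans s1.
apply: (@le_trans _ _ (expR 1 * expR ((c + e) * (1 + S w)))); last first.
  by rewrite -expRD ler_expR [leRHS]mulrDl lerD2r mul1r.
apply: (@le_trans _ _ ((1 + 1) * expR ((c + e) * (1 + S w)))); last first.
  by rewrite ler_wpM2r ?expR_ge0// expR_ge1Dx.
rewrite mulrDl mul1r lerD//.
  by apply: le_trans (fc _ Aw) _; rewrite ler_expR ler_wpM2r// lerDl.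
by apply: le_trans (ge _ Aw) _; rewrite ler_expR ler_wpM2r// lerDr.
Qed.

Lemma exp_boundedZ (a : R) f : exp_bounded A S f -> exp_bounded A S (fun w => a * f w).
Proof. by move=> fb; apply: exp_boundedM => //; exact: exp_bounded_cst. Qed.

Lemma exp_bounded_weight : exp_bounded A S S.
Proof.
exists 1 => // w _; rewrite mul1r ger0_norm//.
apply: le_trans (expR_ge1Dx _); rewrite addrA lerDr //.
Qed.

Lemma exp_bounded_norm f : exp_bounded A S f -> exp_bounded A S (fun w => `|f w|).
Proof. by move=> fb; apply: exp_bounded_le fb _ => w _; rewrite normr_id. Qed.

End exp_bounded_lemmas.

Section euler_bounds.
Context {R : realType} {M : nat} {T : Type}.
Variables (A : set T) (S : T -> R) (S0 : forall w, 0 <= S w).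
Variables (dt : R) (xi : nat -> T -> 'rV[R]_M) (N : nat).
Hypothesis xiS : forall k w, (k < N)%N -> `|xi k w| <= S w.

Lemma exp_bounded_xi k : (k < N)%N -> exp_bounded A S (fun w => `|xi k w|).
Proof.
move=> kN; apply: exp_bounded_le (exp_bounded_weight A S0) _ => w _.
by rewrite normr_id ger0_norm// xiS.
Qed.

Lemma exp_bounded_linear_growth (V : normedModType R) (g : 'rV[R]_M -> V) (a b : R)
    (X : T -> 'rV[R]_M) :
  0 <= a -> 0 <= b -> (forall x, `|g x| <= a + b * `|x|) ->
  exp_bounded A S (fun w => `|X w|) -> exp_bounded A S (fun w => `|g (X w)|).
Proof.
move=> a0 b0 gab Xb; have h : exp_bounded A S (fun w => a + b * `|X w|).
  by apply: exp_boundedD => //; [exact: exp_bounded_cst|exact: exp_boundedZ].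
apply: exp_bounded_le h _ => w _.
by rewrite normr_id [leRHS]ger0_norm ?gab// addr_ge0// mulr_ge0.
Qed.

Lemma exp_bounded_normD (V : normedModType R) (X Y : T -> V) :
  exp_bounded A S (fun w => `|X w|) -> exp_bounded A S (fun w => `|Y w|) ->
  exp_bounded A S (fun w => `|X w + Y w|).
Proof.
move=> Xb Yb; apply: exp_bounded_le (exp_boundedD S0 Xb Yb) _ => w _.
by rewrite normr_id (le_trans (ler_normD _ _))// ler_norm.
Qed.

Lemma exp_bounded_normZ (V : normedModType R) (a : T -> R) (Y : T -> V) :
  exp_bounded A S a -> exp_bounded A S (fun w => `|Y w|) ->
  exp_bounded A S (fun w => `|a w *: Y w|).
Proof.
move=> ab Yb; apply: exp_bounded_le (exp_boundedM ab Yb) _ => w _.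
by rewrite normr_id normrZ normrM normr_id.
Qed.

Lemma exp_bounded_euler_map f (s : 'rV[R]_M -> R^o) (a b : R) x0 n :
  0 <= a -> 0 <= b ->
  (forall x, `|f x| <= a + b * `|x|) -> (forall x, `|s x| <= a + b * `|x|) ->
  (n <= N)%N ->
  exp_bounded A S (fun w => `|euler_map f s dt (xi ^~ w) x0 n|).
Proof.
move=> a0 b0 fab sab; elim: n => [|n IH] nN /=; first exact: exp_bounded_cst.
have {}IH := IH (ltnW nN).
apply: exp_bounded_normD; last first.
  apply: exp_bounded_normZ; last exact: exp_bounded_xi.
  have := exp_bounded_linear_growth a0 b0 sab IH.
  by move=> h; apply: exp_bounded_le h _ => w _; rewrite normr_id.
apply: exp_bounded_normD => //; apply: exp_bounded_normZ; first exact: exp_bounded_cst.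
exact: exp_bounded_linear_growth a0 b0 fab IH.
Qed.

Section difference.
Variables (f : R -> 'rV[R]_M -> 'rV[R]_M) (df : 'rV[R]_M -> 'rV[R]_M).
Variables (s : R -> 'rV[R]_M -> R^o) (ds : 'rV[R]_M -> R^o).
Variables (r L : R) (r0 : 0 < r) (r1 : r <= 1) (L0 : 0 <= L).
Hypotheses (ff : smooth_family f df r L) (fs : smooth_family s ds r L).
Variables (x0 u0 : 'rV[R]_M) (eta : nat -> 'rV[R]_M).

Let X h n w := euler_map (f h) (s h) dt (fun k => xi k w + h *: eta k) (x0 + h *: u0) n.
Let X0 n w := euler_map (f 0) (s 0) dt (xi ^~ w) x0 n.

Lemma exp_bounded_family_euler n : (n <= N)%N -> exp_bounded A S (fun w => `|X0 n w|).
Proof.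
apply: (@exp_bounded_euler_map _ _ (`|f 0 0| + `|s 0 0|) L) => //.
- by move=> x; apply: le_trans (family_bound0 r0 ff x) _; rewrite lerD2r lerDl.
- by move=> x; apply: le_trans (family_bound0 r0 fs x) _; rewrite lerD2r lerDr.
Qed.

(** The bound is uniform over [|h| < r], with all dependence on the path collected in [G]: this is
    the form that dominated convergence asks of the difference quotients. *)
Lemma euler_difference_bound n : (n <= N)%N ->
  exists2 G : T -> R, (forall w, 0 <= G w) & exp_bounded A S G /\
    forall h w, A w -> `|h| < r -> `|X h n w - X0 n w| <= `|h| * G w.
Proof.
elim: n => [|n IH] nN.
  exists (fun=> `|u0|) => //; split; first exact: exp_bounded_cst.
  by move=> h w _ _; rewrite /X /X0 /= addrC addKr normrZ.
have [G G0 [Gb GX]] := IH (ltnW nN).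
have X0b := exp_bounded_family_euler (ltnW nN).
pose D w := L * G w + L * (1 + `|X0 n w|).
have D0 w : 0 <= D w by rewrite /D addr_ge0 ?mulr_ge0 ?addr_ge0.
have Db : exp_bounded A S D.
  apply: exp_boundedD => //; apply: exp_boundedZ => //.
  by apply: exp_boundedD => //; exact: exp_bounded_cst.
have step (V : normedModType R) (g : R -> 'rV[R]_M -> V) dg h w :
    A w -> smooth_family g dg r L -> `|h| < r ->
    `|g h (X h n w) - g 0 (X0 n w)| <= `|h| * D w.
  move=> Aw fg hr; apply: le_trans (family_diff_le fg _ _ hr) _.
  rewrite /D [leRHS]mulrDr lerD2r mulrCA ler_wpM2l//; exact: GX.
pose s0 w : R := `|s 0 (X0 n w)|.
have s00 w : 0 <= s0 w by exact: normr_ge0.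
have s0b : exp_bounded A S s0.
  apply: (@exp_bounded_linear_growth _ _ `|s 0 0| L) => // x.
  exact: (family_bound0 r0 fs x).
(* [D] bounds the increments of both coefficients per unit of [h]. The four terms are the propagated
   error, the drift, the diffusion against the old noise, and the shift of the noise; in the last
   one [D w + s0 w] bounds [|s h (X h n w)|] because [|h| <= 1]. *)
exists (fun w => G w + (`|dt| * D w + (D w * `|xi n w| + (D w + s0 w) * `|eta n|))).
  by move=> w; rewrite !(addr_ge0, mulr_ge0)//.
split.
  apply: exp_boundedD => //; apply: exp_boundedD => //; first exact: exp_boundedZ.
  apply: exp_boundedD => //; apply: exp_boundedM => //; first exact: exp_bounded_xi.
    exact: exp_boundedD.
  exact: exp_bounded_cst.
move=> h w Aw hr; have h1 : `|h| <= 1 by apply: ltW; exact: lt_le_trans hr r1.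
rewrite {1}/X {1}/X0 /= -/(X h n w) -/(X0 n w).
have -> : X h n w + dt *: f h (X h n w) + s h (X h n w) *: (xi n w + h *: eta n) -
    (X0 n w + dt *: f 0 (X0 n w) + s 0 (X0 n w) *: xi n w) =
    (X h n w - X0 n w) + (dt *: (f h (X h n w) - f 0 (X0 n w)) +
     ((s h (X h n w) - s 0 (X0 n w)) *: xi n w + (h * s h (X h n w)) *: eta n)).
  rewrite scalerDr scalerBr scalerBl scalerA [h * _]mulrC.
  have aux (a b c e a0 b0 c0 : 'rV[R]_M) :
      a + b + (c + e) - (a0 + b0 + c0) = a - a0 + (b - b0 + (c - c0 + e)).
    by rewrite opprD addrACA opprD [a + b + _]addrACA [c + e - _]addrAC !addrA.
  exact: aux.
rewrite mulrDr; apply: le_trans (ler_normD _ _) _; apply: lerD; first exact: GX.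
rewrite mulrDr; apply: le_trans (ler_normD _ _) _; apply: lerD.
  by rewrite normrZ mulrCA ler_wpM2l// (step _ _ _ _ _ Aw ff hr).
rewrite mulrDr; apply: le_trans (ler_normD _ _) _; apply: lerD.
  by rewrite normrZ mulrA ler_wpM2r// (step _ _ _ _ _ Aw fs hr).
rewrite normrZ normrM -mulrA ler_wpM2l// ler_wpM2r//.
rewrite -[s h _](subrK (s 0 (X0 n w))); apply: le_trans (ler_normD _ _) _.
rewrite lerD2r; apply: le_trans (step _ _ _ _ _ Aw fs hr) _.
by rewrite ler_piMl.
Qed.

End difference.
End euler_bounds.

(** A property of the target space, so that the vector-valued drift and the scalar diffusion
    coefficient share the construction [smooth_family_intro]. *)
Definition mean_value_bound {R : realType} (V : normedModType R) : Prop :=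
  forall (g l : R -> V) (r C : R),
    (forall c, `|c| < r -> curve_deriv (fun h => g (c + h)) (g c) (l c)) ->
    (forall c, `|c| < r -> `|l c| <= C) ->
    forall h, `|h| < r -> `|g h - g 0| <= `|h| * C.

Section mean_value_bounds.
Context {R : realType}.

Lemma mean_value_bound_real : mean_value_bound R^o.
Proof.
move=> g l r C gl lC h hr.
have dg (c : R) : `|c| < r -> is_derive c (1 : R) (g : R -> R) (l c : R).
  move=> cr; have h1 : k^-1 *: ((g \o shift c) (k *: (1 : R)) - g c) @[k --> 0^'] --> l c.
    by apply: near_cvg (gl c cr); apply: nearW => k /=; rewrite [k *: 1]mulr1 [k + c]addrC.
  by split; [apply/cvg_ex; exists (l c) | exact/cvg_lim].
have cg (c : R) : `|c| < r -> {for c, continuous (g : R -> R)}.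
  move=> cr; apply/differentiable_continuous/derivable1_diffP.
  by have := dg c cr => ?.
have mv a b : a <= b -> (forall c, a <= c <= b -> `|c| < r) ->
    `|g b - g a| <= `|b - a| * C.
  move=> ab abr.
  have dg' c : c \in `]a, b[ -> is_derive c (1 : R) (g : R -> R) (l c : R).
    by rewrite in_itv /= => /andP[ac cb]; apply: dg; apply: abr; rewrite !ltW.
  have cg' : {within `[a, b], continuous (g : R -> R)}.
    apply: continuous_in_subspaceT => c; rewrite inE /= in_itv /= => cab.
    by apply: cg; exact: abr.
  have [c cab ->] := MVT_segment ab dg' cg'.
  rewrite normrM mulrC ler_wpM2l// lC// abr//.
have [h0|h0] := leP 0 h.
  rewrite -[X in `|X| * C]subr0; apply: mv => // c /andP[c0 ch].
  by apply: le_lt_trans hr; rewrite !ger0_norm.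
rewrite distrC -(normrN h) -[- h]sub0r; apply: mv; first exact: ltW.
move=> c /andP[hc c0]; apply: le_lt_trans hr.
by rewrite !ler0_norm ?lerN2// ltW.
Qed.

(** The norm is the sup norm, so the scalar bound applies to each coordinate with the same
    constant. *)
Lemma mean_value_bound_rV M : mean_value_bound 'rV[R]_M.
Proof.
move=> g l r C gl lC h hr.
have C0 : 0 <= C.
  have := lC h hr; exact: le_trans.
apply: rV_normr_le => [|i]; first exact: mulr_ge0.
rewrite !mxE.
apply: (@mean_value_bound_real (fun c => g c 0 i) (fun c => l c 0 i) r) => // c cr.
  have h1 := cvg_comp _ _ (gl c cr) (@coord_continuous R 1 M 0 i (l c)).
  apply: (near_cvg (f := fun k => (k^-1 *: (g (c + k) - g c)) 0 i)); last exact: h1.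
  by apply: nearW => k /=; rewrite !mxE.
exact: le_trans (rV_normr_coord _ _) (lC _ cr).
Qed.

Lemma has_derivative_on_curve (V : normedModType R) (a b : R) (f : R -> V) c l :
  a < c < b -> has_derivative_on `[a, b] f c l ->
  curve_deriv (fun h => f (c + h)) (f c) l.
Proof.
move=> /andP[ac cb] fl U Ul.
have hU : \forall h \near (0 : R)^', `[a, b]%classic (c + h) ->
  U (h^-1 *: (f (c + h) - f c)) by exact: fl U Ul.
suff : \forall h \near (0 : R)^', U (h^-1 *: (f (c + h) - f c)) by [].
near=> h; have := near hU h; apply => //=.
have : `|h| < c - a by near: h; apply: dnbhs0_lt; rewrite subr_gt0.
have : `|h| < b - c by near: h; apply: dnbhs0_lt; rewrite subr_gt0.
rewrite !ltr_norml in_itv /= => /andP[h1 h2] /andP[h3 h4].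
by apply/andP; split; lra.
Unshelve. all: end_near. Qed.

End mean_value_bounds.

(** The mixed increment bound is the mean value inequality for [f c x - f c y] as a function of [c],
    whose derivative is controlled by the Lipschitz bound on [df]; the bound on [f h x - f 0 x] uses
    the growth of [df] instead. The condition on [r] keeps every parameter interior to the interval,
    where the relative derivative is two-sided. *)
Lemma smooth_family_intro {R : realType} {M : nat} {V : normedModType R}
    (f df : R -> 'rV[R]_M -> V) (a b r L : R) :
  mean_value_bound V -> a < 0 -> 0 < b -> 0 < r -> r <= - a -> r <= b ->
  (forall g x, g \in `[a, b] -> differentiable (f g) x) ->
  (forall g x, g \in `[a, b] -> has_derivative_on `[a, b] (fun c => f c x) g (df g x)) ->
  (forall g x y, g \in `[a, b] -> `|f g x - f g y| <= L * `|x - y|) ->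
  (forall g x y, g \in `[a, b] -> `|df g x - df g y| <= L * `|x - y|) ->
  (forall g x, g \in `[a, b] -> `|df g x| <= L * (1 + `|x|)) ->
  smooth_family f (df 0) r L.
Proof.
move=> mvb a0 b0 r0 ra rb fdiff fder flip dflip dfgrow.
have I g : `|g| < r -> a < g < b.
  by rewrite ltr_norml => /andP[g1 g2]; apply/andP; split; lra.
have I' g : `|g| < r -> g \in `[a, b].
  by move=> /I /andP[g1 g2]; rewrite in_itv /= !ltW.
have I0 : (0 : R) \in `[a, b] by rewrite in_itv /= !ltW.
have dc g x : `|g| < r -> curve_deriv (fun h => f (g + h) x) (f g x) (df g x).
  by move=> gr; apply: has_derivative_on_curve (I _ gr) (fder _ _ (I' _ gr)).
split.
- by move=> h x y hr; exact/flip/I'.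
- move=> h x y hr.
  have aux (p q s t : V) : p - q - (s - t) = p - s - (q - t).
    by rewrite !opprB addrACA [RHS]addrACA [- s - q]addrC.
  rewrite aux.
  apply: (mvb (fun c => f c x - f c y) (fun c => df c x - df c y) r) => // c cr.
    have h1 := curve_derivD (dc c x cr) (curve_derivZ (a := -1) (dc c y cr)).
    by rewrite !scaleN1r in h1; apply: near_cvg h1; apply: nearW => k /=; rewrite scaleN1r.
  exact/dflip/I'.
- move=> h x hr; apply: (mvb (f ^~ x) (df ^~ x) r) => // c cr; first exact: dc.
  exact/dfgrow/I'.
- move=> x; have h1 := dc 0 x (etrans (congr1 (fun y => y < r) (normr0 _)) r0).
  by apply: near_cvg h1; apply: nearW => k /=; rewrite add0r.
- by move=> x; exact: fdiff.
Qed.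

(** * Measurability *)

Lemma small_sequence {R : realType} (r : R) : 0 < r ->
  exists u : nat -> R, [/\ forall n, u n != 0, forall n, `|u n| < r
    & u n @[n --> \oo] --> 0].
Proof.
move=> r0; exists (fun n => r / 2 * harmonic n).
have r2 : 0 < r / 2 by rewrite divr_gt0.
split.
- by move=> n; rewrite gt_eqF// mulr_gt0// invr_gt0.
- move=> n; rewrite ger0_norm; last by rewrite mulr_ge0 ?ltW// invr_gt0.
  apply: (@le_lt_trans _ _ (r / 2)); last by rewrite ltr_pdivrMr// ltr_pMr// ltr1n.
  by rewrite ler_piMr ?(ltW r2)// /harmonic /= invf_le1// ler1n.
- have h : r / 2 * harmonic n @[n --> \oo] --> r / 2 * (0 : R).
    by apply: cvgM; [exact: cvg_cst|exact: cvg_harmonic].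
  by rewrite mulr0 in h.
Qed.

Section measurable_rows.
Context {R : realType} {d : measure_display} {T : measurableType d} {M : nat}.

Definition measurable_rV (X : T -> 'rV[R]_M) : Prop :=
  forall i, measurable_fun setT (fun w => X w 0 i : measurableTypeR R).

Lemma measurable_rV_cst (x : 'rV[R]_M) : measurable_rV (fun=> x).
Proof. by move=> i; exact: measurable_cst. Qed.

Lemma measurable_rVD (X Y : T -> 'rV[R]_M) :
  measurable_rV X -> measurable_rV Y -> measurable_rV (fun w => X w + Y w).
Proof.
move=> mX mY i; under eq_fun do rewrite mxE.
exact: measurable_funD (mX i) (mY i).
Qed.

Lemma measurable_rVZ (a : T -> R) (X : T -> 'rV[R]_M) :
  measurable_fun setT (a : T -> measurableTypeR R) -> measurable_rV X ->
  measurable_rV (fun w => a w *: X w).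
Proof.
move=> ma mX i; under eq_fun do rewrite mxE.
exact: measurable_funM ma (mX i).
Qed.

(* [f \o X] is the limit of [f] along the roundings of [X] to the grids
   [Z^M / k], which take countably many values. *)
Lemma measurable_fun_comp_rV (f : 'rV[R]_M -> R^o) (X : T -> 'rV[R]_M) :
  continuous f -> measurable_rV X ->
  measurable_fun setT (fun w => f (X w) : measurableTypeR R).
Proof.
move=> cf mX.
pose Z (k : nat) (w : T) : 'rV[int]_M := \row_i Num.floor (k.+1%:R * X w 0 i).
pose q (k : nat) (z : 'rV[int]_M) : 'rV[R]_M := \row_i ((z 0 i)%:~R / k.+1%:R).
apply: (@measurable_fun_cvg _ _ _ _ (fun k w => f (q k (Z k w)))).
  move=> k _ U mU; rewrite setTI.
  have -> : (fun w => f (q k (Z k w))) @^-1` U =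
      \bigcup_z [set w | U (f (q k z)) /\ forall i, Z k w 0 i = z 0 i].
    apply/seteqP; split=> [w /= Uw|w [z _ /= [Uz Zz]]]; first by exists (Z k w).
    by have -> // : Z k w = z by apply/rowP.
  apply: countable_bigcupT_measurable => [|z]; first exact: countableP.
  have [Uz|nUz] := pselect (U (f (q k z))); last first.
    by rewrite (_ : [set w | _] = set0)//; apply/seteqP; split => // w [].
  rewrite (_ : [set w | _] = \bigcap_(i in [set: 'I_M])
     ((fun w => X w 0 i) @^-1` `[(z 0 i)%:~R / k.+1%:R, (z 0 i + 1)%:~R / k.+1%:R[)).
    apply: fin_bigcap_measurable; first exact: finite_finset.
    by move=> i _; rewrite -[X in measurable X]setTI; exact: mX.
  apply/seteqP; split=> w /=.
    move=> [_ h] i _ /=; rewrite -(h i) in_itv /= /Z mxE.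
    rewrite ler_pdivrMr ?ltr_pdivlMr ?ltr0n// [X w 0 i * _]mulrC.
    by rewrite floor_le_tmp floorD1_gt.
  move=> h; split=> // i; have := h i Logic.I; rewrite /= in_itv /= /Z mxE.
  rewrite ler_pdivrMr ?ltr_pdivlMr ?ltr0n// [X w 0 i * _]mulrC => hz.
  by apply: floor_def.
move=> w _; apply: (@cvg_comp _ _ _ (fun k => q k (Z k w)) f _ (nbhs (X w))); last exact: cf.
apply/cvgrPdist_le => e e0; near=> k.
have k0 : (0 : R) < k.+1%:R by rewrite ltr0n.
have ke : (k.+1%:R)^-1 <= e.
  by apply: ltW; near: k; exact: near_infty_natSinv_lt (PosNum e0).
apply: le_trans ke; apply: rV_normr_le => [|i]; first by rewrite invr_ge0.
rewrite !mxE -{1}[X w 0 i](mulKf (lt0r_neq0 k0)) [_^-1 * _]mulrC -mulrBl normrM.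
rewrite [X in _ * X]ger0_norm ?invr_ge0// ler_piMl ?invr_ge0//.
rewrite ger0_norm; last by rewrite subr_ge0 floor_le_tmp.
rewrite lerBlDl.
by have := floorD1_gt (k.+1%:R * X w 0 i); rewrite rmorphD /= => /ltW.
Unshelve. all: end_near. Qed.

Lemma measurable_rV_comp (f : 'rV[R]_M -> 'rV[R]_M) (X : T -> 'rV[R]_M) :
  continuous f -> measurable_rV X -> measurable_rV (fun w => f (X w)).
Proof.
move=> cf mX i; apply: (@measurable_fun_comp_rV (fun x => f x 0 i)) => // x.
by apply: (@continuous_comp _ _ _ f (fun y : 'rV[R]_M => y 0 i)); [exact: cf|exact: coord_continuous].
Qed.

(** The derivative is the pointwise limit of difference quotients along one null sequence. This
    gives measurability of the spatial derivatives, which are not assumed continuous. *)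
Lemma measurable_curve_deriv (r : R) (g : R -> T -> R) (g0 g' : T -> R^o) :
  0 < r ->
  (forall h, `|h| < r -> measurable_fun setT (g h : T -> measurableTypeR R)) ->
  measurable_fun setT (g0 : T -> measurableTypeR R) ->
  (forall w, curve_deriv (g ^~ w : R -> R^o) (g0 w) (g' w)) ->
  measurable_fun setT (g' : T -> measurableTypeR R).
Proof.
move=> r0 mg mg0 gg'; have [u [u0 ur uc]] := small_sequence r0.
apply: (@measurable_fun_cvg _ _ _ _ (fun k w => (u k)^-1 * (g (u k) w - g0 w))).
  by move=> k; apply: measurable_funM => //; exact: measurable_funB (mg _ (ur k)) mg0.
by move=> w _; have /cvgr_dnbhsP h := gg' w; apply: h.
Qed.

Lemma measurable_diff (f : 'rV[R]_M -> R^o) (X U : T -> 'rV[R]_M) :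
  (forall x, differentiable f x) -> measurable_rV X -> measurable_rV U ->
  measurable_fun setT (fun w => 'd f (X w) (U w) : measurableTypeR R).
Proof.
move=> df mX mU; have cf : continuous f by move=> x; exact: differentiable_continuous.
apply: (@measurable_curve_deriv 1 (fun h w => f (X w + h *: U w)) (fun w => f (X w))).
- by [].
- move=> h _; apply: measurable_fun_comp_rV => //.
  by apply: measurable_rVD => //; apply: measurable_rVZ.
- exact: measurable_fun_comp_rV.
- by move=> w; exact: curve_deriv_comp (df _) (curve_deriv_line _ _).
Qed.

Lemma measurable_rV_diff (f : 'rV[R]_M -> 'rV[R]_M) (X U : T -> 'rV[R]_M) :
  (forall x, differentiable f x) -> measurable_rV X -> measurable_rV U ->
  measurable_rV (fun w => 'd f (X w) (U w)).
Proof.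
move=> df mX mU i; have cf : continuous f by move=> x; exact: differentiable_continuous.
apply: (@measurable_curve_deriv 1 (fun h w => f (X w + h *: U w) 0 i) (fun w => f (X w) 0 i)).
- by [].
- move=> h _; apply: (measurable_rV_comp cf).
  by apply: measurable_rVD => //; apply: measurable_rVZ.
- exact: (measurable_rV_comp cf).
- move=> w; have h1 := curve_deriv_comp (df (X w)) (curve_deriv_line (X w) (U w)).
  have h2 := cvg_comp _ _ h1 (@coord_continuous R 1 M 0 i _).
  apply: (near_cvg (f := fun k => (k^-1 *: (f (X w + k *: U w) - f (X w))) 0 i)); last exact: h2.
  by apply: nearW => k /=; rewrite !mxE.
Qed.

End measurable_rows.

(** * Cameron-Martin formula in one coordinate *)

Section density.
Local Open Scope ereal_scope.
Context {d} {T : measurableType d} {R : realType}.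
Variables (mu nu : {measure set T -> \bar R}) (g : T -> R).
Hypotheses (g0 : forall x, (0 <= g x)%R) (mg : measurable_fun setT g).
Hypothesis nuE : forall A, measurable A -> nu A = \int[mu]_(x in A) (g x)%:E.

Import HBNNSimple.

Lemma nnsfun_integral_density (f : {nnsfun T >-> R}) :
  \int[nu]_x (f x)%:E = \int[mu]_x ((f x)%:E * (g x)%:E).
Proof.
have mf k : measurable (f @^-1` [set k]) by exact: measurable_funPTI.
under eq_integral do rewrite fimfunE -fsumEFin//.
rewrite ge0_integral_fsum//; last 2 first.
- by move=> k; apply/measurable_EFinP/measurable_funM => //; exact: measurable_indic.
- by move=> k x _; rewrite EFinM nnfun_muleindic_ge0.
under [RHS]eq_integral => x _.
  rewrite fimfunE -fsumEFin// ge0_mule_fsuml; last first.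
    by move=> k; rewrite EFinM nnfun_muleindic_ge0.
  over.
rewrite ge0_integral_fsum//; last 2 first.
- move=> k; apply: emeasurable_funM; last exact/measurable_EFinP.
  by apply/measurable_EFinP/measurable_funM => //; exact: measurable_indic.
- by move=> k x _; rewrite mule_ge0 ?lee_fin// -lee_fin EFinM nnfun_muleindic_ge0.
apply: eq_fsbigr => k; rewrite inE => -[t _ <-].
have ft0 : 0 <= (f t)%:E by rewrite lee_fin.
under eq_integral do rewrite EFinM.
under [RHS]eq_integral do rewrite EFinM -muleA.
rewrite !ge0_integralZl//; last 3 first.
- apply: emeasurable_funM; last exact/measurable_EFinP.
  by apply/measurable_EFinP; exact: measurable_indic.
- by move=> x _; rewrite mule_ge0 ?lee_fin.
- by apply/measurable_EFinP; exact: measurable_indic.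
rewrite integral_indic// setIT nuE//; congr (_ * _).
rewrite integral_mkcond; apply: eq_integral => x _.
by rewrite patchE indicE; case: ifPn => xf; rewrite ?mul1e ?mul0e.
Qed.

Lemma ge0_integral_density (f : T -> \bar R) : measurable_fun setT f ->
  (forall x, 0 <= f x) -> \int[nu]_x f x = \int[mu]_x (f x * (g x)%:E).
Proof.
move=> mf f0; pose f_ := nnsfun_approx measurableT mf.
have fE x : f x = limn (fun n => (f_ n x)%:E).
  by apply/esym/cvg_lim => //; exact: cvg_nnsfun_approx.
have gE x : f x * (g x)%:E = limn (fun n => (f_ n x)%:E * (g x)%:E).
  apply/esym/cvg_lim => //; apply: cvgeZr => //.
  by apply: cvg_nnsfun_approx.
under eq_integral do rewrite fE.
under [RHS]eq_integral do rewrite gE.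
rewrite !monotone_convergence//.
- by congr (limn _); apply/funext => n; exact: nnsfun_integral_density.
- move=> n; apply: emeasurable_funM; last exact/measurable_EFinP.
  exact/measurable_EFinP.
- by move=> n x _; rewrite mule_ge0 ?lee_fin.
- by move=> x _ m n mn; rewrite lee_wpmul2r ?lee_fin//; exact/lefP/nd_nnsfun_approx.
- by move=> n; exact/measurable_EFinP.
- by move=> n x _; rewrite lee_fin.
- by move=> x _ m n mn; rewrite lee_fin; exact/lefP/nd_nnsfun_approx.
Qed.

End density.

Section cameron_martin_real.
Local Open Scope ereal_scope.
Context {R : realType}.
Notation mu := (@lebesgue_measure R).
Implicit Types f : measurableTypeR R -> \bar R.

Let shift_fun (h : R) (x : measurableTypeR R) : measurableTypeR R := (x + h)%R.

Let measurable_shift h : measurable_fun setT (shift_fun h).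
Proof. exact: (measurable_funD (@measurable_id _ _ _) (@measurable_cst _ _ _ _ _ h)). Qed.

Lemma lebesgue_measure_shift (h : R) (A : set (measurableTypeR R)) : measurable A ->
  mu A = mu [set x | A (x + h)%R].
Proof.
move=> mA.
apply: (@lebesgue_measure_unique R
  (measure_function_pushforward__canonical__measure_function_Measure mu (measurable_shift h))) => //.
move=> _ [[a b] _ <-] /=; rewrite /pushforward.
rewrite [X in _ = mu X](_ : _ = `](a - h)%R, (b - h)%R]%classic); last first.
  by apply/seteqP; split=> x /=; rewrite !in_itv /= ltrBlDr lerBrDr.
by rewrite !lebesgue_measure_itv /= !lte_fin ltrD2r -!EFinB opprB addrA subrK.
Qed.

Lemma ge0_integral_lebesgue_shift f (h : R) : measurable_fun setT f ->
  (forall x, 0 <= f x) -> \int[mu]_x f (x + h)%R = \int[mu]_x f x.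
Proof.
move=> mf f0.
have := @ge0_integral_pushforward _ _ _ _ _ _ (measurable_shift h) mu setT f measurableT mf (fun y _ => f0 y).
rewrite preimage_setT => <-.
apply: eq_measure_integral => A mA _; rewrite /pushforward.
by rewrite [RHS](lebesgue_measure_shift h).
Qed.

Variable s : R.
Hypothesis s0 : (s != 0)%R.

(** Density of the normal law of mean [h] with respect to the centered one, both of standard
    deviation [s]. *)
Definition shift_density (h x : R) : R := expR ((h * x - h ^+ 2 / 2) / s ^+ 2).

Lemma normal_pdf_shift (h x : R) :
  normal_pdf 0 s (x - h) = (normal_pdf 0 s x * shift_density h x)%R.
Proof.
rewrite normal_pdfE// -mulrA; congr (_ * _)%R.
rewrite /normal_fun /shift_density -expRD; congr expR.
rewrite !subr0 -mulr_natr; field.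
by rewrite s0.
Qed.

Lemma measurable_shift_density h :
  measurable_fun setT (shift_density h : measurableTypeR R -> measurableTypeR R).
Proof.
apply: measurableT_comp => //; apply: measurable_funM => //.
by apply: measurable_funB => //; exact: measurable_funM.
Qed.

Lemma ge0_integral_normal_prob f : measurable_fun setT f -> (forall x, 0 <= f x) ->
  \int[normal_prob 0 s]_x f x = \int[mu]_x (f x * (normal_pdf 0 s x)%:E).
Proof.
move=> mf f0.
by apply: ge0_integral_density => //; [exact: normal_pdf_ge0|exact: measurable_normal_pdf].
Qed.

(** Translation invariance of Lebesgue measure moves the shift onto the normal density, where it
    becomes the factor [shift_density]. *)
Lemma ge0_cameron_martin f (h : R) : measurable_fun setT f -> (forall x, 0 <= f x) ->
  \int[normal_prob 0 s]_x f (x + h)%R =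
  \int[normal_prob 0 s]_x (f x * (shift_density h x)%:E).
Proof.
move=> mf f0.
have md : measurable_fun setT (fun x => f x * (shift_density h x)%:E).
  apply: emeasurable_funM => //; apply/measurable_EFinP; exact: measurable_shift_density.
have mp := @measurable_normal_pdf R 0 s.
have mfh : measurable_fun setT (f \o shift_fun h).
  exact: (measurableT_comp mf (measurable_shift h)).
rewrite !ge0_integral_normal_prob//; last first.
  by move=> x; rewrite mule_ge0// lee_fin expR_ge0.
rewrite -(@ge0_integral_lebesgue_shift (fun x => f x * (shift_density h x)%:E * (normal_pdf 0 s x)%:E) h); last 2 first.
- by apply: emeasurable_funM => //; exact/measurable_EFinP.
- by move=> x; rewrite !mule_ge0// lee_fin ?expR_ge0 ?normal_pdf_ge0.
apply: eq_integral => x _; rewrite -muleA -EFinM [(shift_density _ _ * _)%R]mulrC.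
by rewrite -normal_pdf_shift addrK.
Qed.

End cameron_martin_real.

Section cameron_martin.
Local Open Scope ereal_scope.
Context {R : realType} {d : measure_display} {Omega : measurableType d}.
Variables (P : probability Omega R) (K : set (set Omega)) (zeta : Omega -> R) (s : R).
Hypotheses (s0 : (s != 0)%R) (KI : setI_closed K) (KT : K setT).
Hypotheses (Km : K `<=` measurable).
Hypothesis mzeta : measurable_fun setT (zeta : Omega -> measurableTypeR R).
Hypothesis KP : forall (E : set Omega) (U : set (measurableTypeR R)),
  K E -> measurable U -> P (E `&` zeta @^-1` U) = P E * normal_prob 0 s U.

(** The same points with the smaller sigma-algebra: measurability on [OmegaK] is how independence of
    [zeta] is expressed below. *)
Let OmegaK := g_sigma_algebraType K.

Let sKm (E : set Omega) : <<s K >> E -> measurable E.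
Proof. by move=> KE; apply: (smallest_sub _ Km) KE; exact: sigma_algebra_measurable. Qed.

(** For fixed [U], both sides are finite measures in [E] that agree on the pi-system [K], hence on
    the sigma-algebra it generates. *)
Let sKP (E : set Omega) (U : set (measurableTypeR R)) :
  <<s K >> E -> measurable U -> P (E `&` zeta @^-1` U) = P E * normal_prob 0 s U.
Proof.
move=> KE mU.
have mzU : measurable (zeta @^-1` U) by rewrite -[X in measurable X]setTI; exact: mzeta.
have c0 : (0 <= fine (normal_prob 0 s U))%R by rewrite fine_ge0.
have nE : (fine (normal_prob 0 s U))%:E = normal_prob 0 s U by rewrite fineK// fin_num_measure.
have mE A : (mrestr P mzU A = mscale (NngNum c0) P A) =
    (P (A `&` zeta @^-1` U) = P A * normal_prob 0 s U).
  by rewrite /mrestr /mscale /= nE [in RHS]muleC.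
rewrite -mE; apply: (@g_sigma_algebra_measure_unique _ R Omega K Km (fun=> setT)) => //.
- by rewrite bigcup_const.
- by move=> A KA; rewrite mE KP.
- move=> _; apply: (le_lt_trans _ (ltry 1)).
  by apply: probability_le1; exact: measurableI.
Qed.

Let rho (w : Omega) : OmegaK * measurableTypeR R := (w, zeta w).

Let mrho : measurable_fun setT rho.
Proof.
apply: measurable_fun_pair => // _ A KA; rewrite setTI; exact: sKm.
Qed.

Let midK : measurable_fun setT (fun w : Omega => w : OmegaK).
Proof. by move=> _ A KA; rewrite setTI; exact: sKm. Qed.

Let PKm : {measure set OmegaK -> \bar R} :=
  measure_function_pushforward__canonical__measure_function_Measure P midK.

Let PKT : PKm setT = 1.
Proof. by rewrite /PKm /= /pushforward preimage_setT probability_setT. Qed.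

Let PKmix := Measure_isProbability.Build _ _ _ PKm PKT.

Let PK : probability OmegaK R := HB.pack (Measure.sort PKm) PKmix.

(** By [sKP], the image of [P] under [rho] has the product values on rectangles, so it is the
    product measure; Tonelli then separates the two variables. *)
Lemma ge0_integral_indep (H : OmegaK * measurableTypeR R -> \bar R) :
  measurable_fun setT H -> (forall z, 0 <= H z) ->
  \int[P]_w H (w, zeta w) = \int[PK]_w \int[normal_prob 0 s]_x H (w, x).
Proof.
move=> mH H0.
have := @fubini_tonelli1 _ _ _ _ _ PK (normal_prob 0 s) H mH H0.
rewrite /fubini_F => <-.
have h := @ge0_integral_pushforward _ _ _ _ _ _ mrho P setT H measurableT mH (fun y _ => H0 y).
rewrite preimage_setT in h; rewrite -h.
apply: (@eq_measure_integral _ _ _ _ (PK \x normal_prob 0 s)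
  (measure_function_pushforward__canonical__measure_function_Measure P mrho)) => A mA _.
apply/esym; apply: (@product_measure_unique _ _ _ _ _ PK (normal_prob 0 s)
  (measure_function_pushforward__canonical__measure_function_Measure P mrho)) => //.
Qed.

Lemma ge0_cameron_martin_indep (H : OmegaK * measurableTypeR R -> \bar R) (h : R) :
  measurable_fun setT H -> (forall z, 0 <= H z) ->
  \int[P]_w H (w, (zeta w + h)%R) =
  \int[P]_w (H (w, zeta w) * (shift_density s h (zeta w))%:E).
Proof.
move=> mH H0.
pose H1 (z : OmegaK * measurableTypeR R) := H (z.1, (z.2 + h)%R).
pose H2 (z : OmegaK * measurableTypeR R) := H z * (shift_density s h z.2)%:E.
have mH1 : measurable_fun setT H1.
  apply: (measurableT_comp mH); apply: measurable_fun_pair => //.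
  exact: measurable_funD.
have mH2 : measurable_fun setT H2.
  apply: emeasurable_funM => //; apply/measurable_EFinP.
  exact: (measurableT_comp (measurable_shift_density s h)).
rewrite [LHS](ge0_integral_indep mH1); last by move=> z; exact: H0.
rewrite [RHS](ge0_integral_indep mH2); last first.
  by move=> z; rewrite mule_ge0// lee_fin expR_ge0.
apply: eq_integral => w _; rewrite /H1 /H2 /=.
apply: (@ge0_cameron_martin _ s s0 (fun x => H (w, x))) => //.
exact: (measurableT_comp mH (measurable_fun_pair _ _)).
Qed.

(** Multiplication by the nonnegative density commutes with positive and negative parts, which
    reduces the signed case to the nonnegative one. *)
Lemma cameron_martin_indep (H : OmegaK * measurableTypeR R -> R) (h : R) :
  measurable_fun setT (H : _ -> measurableTypeR R) ->
  \int[P]_w (H (w, (zeta w + h)%R))%:E =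
  \int[P]_w (H (w, zeta w) * shift_density s h (zeta w))%:E.
Proof.
move=> mH; have mEH : measurable_fun setT (EFin \o H) by exact/measurable_EFinP.
rewrite [LHS]integralE [RHS]integralE; congr (_ - _).
  transitivity (\int[P]_w ((EFin \o H)^\+ (w, zeta w) * (shift_density s h (zeta w))%:E)).
    have cm := (@ge0_cameron_martin_indep ((EFin \o H)^\+) h (measurable_funepos mEH) (fun z => funepos_ge0 _ z)).
    by rewrite -cm; apply: eq_integral => w _; rewrite !(funeposE, funenegE).
  apply: eq_integral => w _.
  by rewrite !(funeposE, funenegE) EFinM -?mulNe maxe_pMl ?mul0e ?lee_fin ?expR_ge0.
transitivity (\int[P]_w ((EFin \o H)^\- (w, zeta w) * (shift_density s h (zeta w))%:E)).
  have cm := (@ge0_cameron_martin_indep ((EFin \o H)^\-) h (measurable_funeneg mEH) (fun z => funeneg_ge0 _ z)).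
  by rewrite -cm; apply: eq_integral => w _; rewrite !(funeposE, funenegE).
apply: eq_integral => w _.
by rewrite !(funeposE, funenegE) EFinM -?mulNe maxe_pMl ?mul0e ?lee_fin ?expR_ge0.
Qed.

End cameron_martin.

(** * Independence of Brownian increments *)

Section generated_sigma_algebras.
Context {R : realType} {Omega : pointedType} {M : nat}.
Implicit Types (G : set (set Omega)).

Lemma sigma_algebraI_gen G A E : <<s G >> A -> <<s G >> E -> <<s G >> (A `&` E).
Proof. exact: (@measurableI _ (g_sigma_algebraType G)). Qed.

Lemma sigma_rvec_preimage (X : Omega -> 'rV[R]_M) i (U : set (measurableTypeR R)) :
  measurable U -> sigma_rvec X ((fun w => X w 0 i) @^-1` U).
Proof.
move=> mU; apply: sub_sigma_algebra; exists i => //.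
by exists U => //; rewrite setTI.
Qed.

Lemma sigma_rvec_sub (X : Omega -> 'rV[R]_M) G :
  (forall i, measurable_fun setT
     (fun w : g_sigma_algebraType G => X w 0 i : measurableTypeR R)) ->
  sigma_rvec X `<=` <<s G >>.
Proof.
move=> mX; apply: smallest_sub; first exact: smallest_sigma_algebra.
by move=> _ [i _ [U mU <-]]; exact: mX.
Qed.

Lemma sigma_rvec_rect (X : Omega -> 'rV[R]_M) (U : 'I_M -> set R) :
  (forall i, measurable (U i : set (measurableTypeR R))) ->
  sigma_rvec X [set w | forall i, U i (X w 0 i)].
Proof.
move=> mU.
rewrite (_ : [set w | _] = \bigcap_(i in [set: 'I_M]) ((fun w => X w 0 i) @^-1` U i)); last first.
  by apply/seteqP; split => w /= h i => [_|]; apply: h.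
pose G := \bigcup_(i : 'I_M) preimage_set_system setT (fun w => X w 0 i)
        (@measurable _ (measurableTypeR R)).
apply: (@fin_bigcap_measurable _ (g_sigma_algebraType G)); first exact: finite_finset.
by move=> i _; exact: sigma_rvec_preimage.
Qed.

Variable B : R -> Omega -> 'rV[R]_M.

Lemma natural_filtration_mono s t : s <= t ->
  natural_filtration B s `<=` natural_filtration B t.
Proof.
move=> st; apply: smallest_sub; first exact: smallest_sigma_algebra.
move=> A [u /= us sA]; apply: sub_sigma_algebra; exists u => //=.
by move: us; rewrite !in_itv /= => /andP[-> us]; exact: le_trans st.
Qed.

Definition filtration_type (t : R) : measurableType _ :=
  g_sigma_algebraType (\bigcup_(tau in `[0, t]%classic) sigma_rvec (B tau)).

Lemma measurable_natural_filtration s t i : 0 <= s <= t ->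
  measurable_fun setT (fun w : filtration_type t => B s w 0 i : measurableTypeR R).
Proof.
move=> st _ U mU; rewrite setTI; apply: sub_sigma_algebra.
by exists s; [rewrite /= in_itv|exact: sigma_rvec_preimage].
Qed.

Lemma sigma_rvec_sub_filtration (X : Omega -> 'rV[R]_M) t :
  (forall i, measurable_fun setT (fun w : filtration_type t => X w 0 i : measurableTypeR R)) ->
  sigma_rvec X `<=` natural_filtration B t.
Proof. exact: sigma_rvec_sub. Qed.

End generated_sigma_algebras.

Section brownian_increments.
Context {R : realType} {d : measure_display} {Omega : measurableType d}.
Variables (P : probability Omega R) (M : nat) (B : R -> Omega -> 'rV[R]_M).
Hypothesis B_bm : standard_brownian_motion P B.
Variables (dt : R) (dt0 : (0 < dt)%R).

Let time (n : nat) : R := (n%:R * dt)%R.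
Let W := increment B dt.

Let time_ge0 n : (0 <= time n)%R.
Proof. by rewrite mulr_ge0// ltW. Qed.

Let time_mono m n : (m <= n)%N -> (time m <= time n)%R.
Proof. by move=> mn; apply: ler_wpM2r; [exact: ltW|rewrite ler_nat]. Qed.

Let time_lt n : (0 <= time n < time n.+1)%R.
Proof. by rewrite time_ge0 /= ltr_pM2r// ltr_nat. Qed.

Lemma measurable_increment_filtration m n i : (m < n)%N ->
  measurable_fun setT
    (fun w : filtration_type B (n%:R * dt) => increment B dt m w 0 i : measurableTypeR R).
Proof.
move=> mn; have -> : (fun w => increment B dt m w 0 i) =
    (fun w => B (m.+1%:R * dt) w 0 i - B (m%:R * dt) w 0 i).
  by apply/funext => w; rewrite !mxE.
apply: measurable_funB; apply: measurable_natural_filtration.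
  by apply/andP; split; [exact: time_ge0|exact: time_mono].
by apply/andP; split; [exact: time_ge0|apply: time_mono; exact: ltnW].
Qed.

Lemma natural_filtration_measurable t : natural_filtration B t `<=` measurable.
Proof.
apply: smallest_sub; first exact: sigma_algebra_measurable.
move=> E [s /=]; rewrite in_itv /= => /andP[s0 _].
apply: smallest_sub; first exact: sigma_algebra_measurable.
by move=> _ [i _ [U mU <-]]; exact: (bm_measurable B_bm i s0).
Qed.

Lemma measurable_increment m : measurable_rV (increment B dt m).
Proof.
move=> i; under eq_fun do rewrite !mxE.
by apply: measurable_funB; apply: (bm_measurable B_bm); exact: time_ge0.
Qed.

Lemma increment_indep n A E : natural_filtration B (n%:R * dt) A ->
  sigma_rvec (increment B dt n) E -> (P (A `&` E) = P A * P E)%E.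
Proof. by move=> FA sE; exact: (bm_independent B_bm (time_lt n) FA sE). Qed.

Lemma increment_rect n (U : 'I_M -> set R) :
  (forall i, measurable (U i : set (measurableTypeR R))) ->
  P [set w | forall i, U i (increment B dt n w 0 i)] =
  (\prod_(i < M) normal_prob 0 (Num.sqrt dt) (U i))%E.
Proof.
move=> mU; have tE : time n.+1 - time n = dt.
  by rewrite /time -natr1 mulrDl mul1r addrAC subrr add0r.
by have := bm_gaussian B_bm (time_lt n) mU; rewrite -/(time n) -/(time n.+1) tE.
Qed.

Variables (n : nat) (i : 'I_M).

(* A pi-system generating the sigma-algebra of the past up to step [n], the
   coordinates other than [i] of the [n]-th increment, and the [k] increments
   that follow. *)
Fixpoint other_noise (k : nat) : set (set Omega) :=
  if k is l.+1 then
    [set E | exists A D, [/\ other_noise l A, sigma_rvec (increment B dt (n.+1 + l)) D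
      & E = A `&` D]]
  else
    [set E | exists A U, [/\ natural_filtration B (n%:R * dt) A,
      forall j, measurable (U j : set (measurableTypeR R)), U i = setT
      & E = A `&` [set w | forall j, U j (increment B dt n w 0 j)]]].

Lemma other_noiseI k : setI_closed (other_noise k).
Proof.
elim: k => [|k IH] E1 E2 /=.
  move=> [A1 [U1 [FA1 mU1 U1i ->]]] [A2 [U2 [FA2 mU2 U2i ->]]].
  exists (A1 `&` A2), (fun j => U1 j `&` U2 j); split.
  - exact: sigma_algebraI_gen.
  - by move=> j; exact: measurableI.
  - by rewrite U1i U2i setIT.
  - rewrite setIACA; congr (_ `&` _); apply/seteqP; split => w /=.
      by move=> [h1 h2] j; split; [exact: h1|exact: h2].
    by move=> h; split => j; have [] := h j.
move=> [A1 [D1 [KA1 sD1 ->]]] [A2 [D2 [KA2 sD2 ->]]].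
exists (A1 `&` A2), (D1 `&` D2); split; [exact: IH| exact: sigma_algebraI_gen|].
by rewrite setIACA.
Qed.

Lemma other_noise_past k A : natural_filtration B (n%:R * dt) A -> other_noise k A.
Proof.
move=> FA; elim: k => [|k IH] /=.
  exists A, (fun=> setT); split => //.
  by rewrite [X in _ `&` X](_ : _ = setT) ?setIT//; apply/seteqP.
exists A, setT; split => //; last by rewrite setIT.
exact: (@measurableT _ (g_sigma_algebraType _)).
Qed.

Lemma other_noiseT k : other_noise k setT.
Proof. by apply: other_noise_past; exact: (@measurableT _ (g_sigma_algebraType _)). Qed.

Lemma other_noiseS k : other_noise k `<=` other_noise k.+1.
Proof.
move=> E KE; exists E, setT; split => //; last by rewrite setIT.
exact: (@measurableT _ (g_sigma_algebraType _)).
Qed.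

Lemma other_noise_mono k l : (k <= l)%N -> other_noise k `<=` other_noise l.
Proof.
elim: l => [|l IH]; first by rewrite leqn0 => /eqP ->.
rewrite leq_eqVlt => /predU1P[->//|]; rewrite ltnS => kl.
by apply: subset_trans (IH kl) _; exact: other_noiseS.
Qed.

Lemma other_noise_coord k j (U : set (measurableTypeR R)) : j != i -> measurable U ->
  other_noise k [set w | U (increment B dt n w 0 j)].
Proof.
move=> ji mU; apply: (@other_noise_mono 0 k) => //=.
exists setT, (fun l => if l == j then U else setT); split.
- exact: (@measurableT _ (g_sigma_algebraType _)).
- by move=> l; case: ifP.
- by rewrite eq_sym (negbTE ji).
- rewrite setTI; apply/seteqP; split => w /=; last by move=> /(_ j); rewrite eqxx.
  by move=> Uw l; case: eqP => // ->.
Qed.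

Lemma other_noise_future k l D : (l < k)%N ->
  sigma_rvec (increment B dt (n.+1 + l)) D -> other_noise k D.
Proof.
move=> lk sD; apply: (other_noise_mono lk).
by exists setT, D; split => //; [exact: other_noiseT|rewrite setTI].
Qed.

(** Places these events in the past of the next increment, which is what lets
    [increment_coord_indep] add one increment at a time. *)
Lemma other_noise_filtration k :
  other_noise k `<=` natural_filtration B ((n.+1 + k)%:R * dt).
Proof.
elim: k => [|k IH] E /=.
  move=> [A [U [FA mU _ ->]]]; rewrite addn0; apply: sigma_algebraI_gen.
    by apply: natural_filtration_mono FA; exact: time_mono.
  have sU := sigma_rvec_rect (X := increment B dt n) mU.
  apply: (@sigma_rvec_sub_filtration _ _ _ _ (increment B dt n)) sU => j.
  exact: measurable_increment_filtration.
move=> [A [D [KA sD ->]]]; apply: sigma_algebraI_gen.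
  apply: natural_filtration_mono (IH _ KA); apply: time_mono.
  by rewrite addnS.
apply: (@sigma_rvec_sub_filtration _ _ _ _ (increment B dt (n.+1 + k))) sD => j.
apply: measurable_increment_filtration.
by rewrite addnS.
Qed.

Lemma other_noise_measurable k : other_noise k `<=` measurable.
Proof.
by apply: subset_trans (@other_noise_filtration k) _; exact: natural_filtration_measurable.
Qed.

(** Without later increments this combines independence from the past with the product form of the
    law of one increment. Each later increment is then split off as independent of all that precedes
    it, the event on the distinguished coordinate included. *)
Lemma increment_coord_indep k (E : set Omega) (U : set (measurableTypeR R)) :
  other_noise k E -> measurable U ->
  P (E `&` (fun w => increment B dt n w 0 i) @^-1` U) =
  (P E * normal_prob 0 (Num.sqrt dt) U)%E.
Proof.
move=> + mU; elim: k E => [|k IH] E /=.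
  move=> [A [V [FA mV Vi ->]]].
  (* Slot [i] of [V] is the whole line, so [U] can be inserted there and the event remains a
     rectangle. *)
  pose V' j := if j == i then U else V j.
  have mV' j : measurable (V' j : set (measurableTypeR R)) by rewrite /V'; case: ifP.
  rewrite -setIA [X in A `&` X](_ : _ = [set w | forall j, V' j (increment B dt n w 0 j)]).
    rewrite (increment_indep FA (sigma_rvec_rect (X := increment B dt n) mV')).
    rewrite (increment_indep FA (sigma_rvec_rect (X := increment B dt n) mV)).
    rewrite !increment_rect// -muleA; congr (_ * _)%E.
    rewrite (bigD1 i)//= [X in _ = (X * _)%E](bigD1 i)//= /V' eqxx Vi probability_setT mul1e muleC.
    by congr (_ * _)%E; apply: eq_bigr => j /negbTE ->.
  apply/seteqP; split => w /=.
    by move=> [h Uw] j; rewrite /V'; case: eqP => [->|_].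
  move=> h; split; last by have := h i; rewrite /V' eqxx.
  by move=> j; have := h j; rewrite /V'; case: eqP => [->|//]; rewrite Vi.
move=> [A [D [KA sD ->]]].
have FA := other_noise_filtration KA.
rewrite setIAC (increment_indep _ sD); last first.
  apply: sigma_algebraI_gen => //.
  have nk : (n < n.+1 + k)%N by rewrite addSn ltnS leq_addr.
  by have := @measurable_increment_filtration n (n.+1 + k)%N i nk measurableT U mU; rewrite setTI.
by rewrite (increment_indep FA sD) IH// muleAC.
Qed.

End brownian_increments.

(** * Differentiation under the expectation *)

Section differentiation_under_expectation.
Context {R : realType} {d : measure_display} {T : measurableType d}.
Variables (mu : {measure set T -> \bar R}).
Variables (r : R) (f : R -> T -> R) (f0 f' G : T -> R^o).
Hypotheses (r0 : 0 < r).
Hypothesis if_ : forall h, `|h| < r -> mu.-integrable setT (EFin \o f h).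
Hypothesis if0 : mu.-integrable setT (EFin \o f0).
Hypothesis iG : mu.-integrable setT (EFin \o G).
Hypothesis ff' : forall w, curve_deriv (f ^~ w : R -> R^o) (f0 w) (f' w).
Hypothesis fG : {ae mu, forall w, forall h, `|h| < r -> `|f h w - f0 w| <= `|h| * G w}.

Let mf' : measurable_fun setT (f' : T -> measurableTypeR R).
Proof.
apply: (measurable_curve_deriv r0 _ _ ff').
  by move=> h hr; apply/measurable_EFinP; exact: measurable_int (if_ hr).
by apply/measurable_EFinP; exact: measurable_int if0.
Qed.

Let seq_cvg (u : nat -> R) : (forall n, u n != 0) -> (forall n, `|u n| < r) ->
  u n @[n --> \oo] --> 0 ->
  mu.-integrable setT (EFin \o f') /\
  (u n)^-1 * (\int[mu]_w f (u n) w - \int[mu]_w f0 w) @[n --> \oo] --> \int[mu]_w f' w.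
Proof.
move=> u0 ur uc.
pose g n w : R := (u n)^-1 * (f (u n) w - f0 w).
have ig n : mu.-integrable setT (EFin \o g n).
  rewrite (_ : EFin \o g n = fun w => ((u n)^-1)%:E * ((f (u n) w)%:E - (f0 w)%:E))%E.
    by apply: integrableZl => //; apply: integrableB => //; exact: if_.
  by apply/funext => w; rewrite /= -EFinB -EFinM.
have gcvg : {ae mu, forall w, setT w -> (EFin \o g n) w @[n --> \oo] --> (f' w)%:E}.
  apply: aeW => w _; apply/fine_cvgP; split; first exact: nearW.
  by have /cvgr_dnbhsP h := @ff' w; apply: h.
have gG : {ae mu, forall w n, setT w -> (`|(EFin \o g n) w| <= (EFin \o G) w)%E}.
  apply: filterS fG => w fGw n _ /=.
  by rewrite lee_fin normrM normfV ler_pdivrMl ?normr_gt0// fGw.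
have mf'E : measurable_fun setT (EFin \o f') by exact/measurable_EFinP.
have [if' _ cf'] := @dominated_convergence _ _ _ mu setT measurableT
  (fun n => EFin \o g n) (EFin \o f') (EFin \o G)
  (fun n => measurable_int _ (ig n)) mf'E gcvg iG gG.
split=> //.
have gE n : (\int[mu]_w g n w = (u n)^-1 * (\int[mu]_w f (u n) w - \int[mu]_w f0 w)).
  rewrite -RintegralB//; last exact: if_.
  rewrite -RintegralZl//.
  rewrite (_ : EFin \o _ = fun w => ((f (u n) w)%:E - (f0 w)%:E))%E//.
  by apply: integrableB => //; exact: if_.
apply: (near_cvg (f := fun n => \int[mu]_w g n w)); first exact: nearW.
apply: fine_cvg; rewrite fineK; last exact: integrable_fin_num.
exact: cf'.
Qed.

Lemma curve_deriv_expectation :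
  mu.-integrable setT (EFin \o f') /\
  curve_deriv (fun h => \int[mu]_w f h w : R^o) (\int[mu]_w f0 w) (\int[mu]_w f' w).
Proof.
split.
  by have [u [u0 ur uc]] := small_sequence r0; have [] := seq_cvg u0 ur uc.
apply/cvgr_dnbhsP => u [u0 uc].
(* The sequence may start outside the interval where the bounds hold, so only a tail of it is
   used. *)
have [k _ kr] : \forall n \near \oo, `|u n| < r by exact: (@cvgr0_norm_lt _ _ _ _ _ _ uc _ r0).
rewrite -(cvg_shiftn k).
apply: (seq_cvg (u := fun n => u (n + k)%N) _ _ _).2 => //.
  by move=> n; apply: kr; rewrite /= leq_addl.
by rewrite cvg_shiftn.
Qed.

End differentiation_under_expectation.

Section shift_density_lemmas.
Context {R : realType}.
Variables (s : R) (s0 : s != 0).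

(** This derivative at zero shift is the origin of the factor [Delta B_n / dt] in the integration by
    parts, where [s ^+ 2 = dt]. *)
Lemma curve_deriv_shift_density (x : R) :
  curve_deriv (fun h => shift_density s h x : R^o) 1 (x / s ^+ 2).
Proof.
pose y (h : R) : R^o := (h * x - h ^+ 2 / 2) / s ^+ 2.
have dy : curve_deriv y 0 (x / s ^+ 2).
  have h1 : (x - h / 2) / s ^+ 2 @[h --> 0^'] --> (x - 0 / 2) / s ^+ 2.
    apply: cvgM; last exact: cvg_cst.
    apply: cvgB; first exact: cvg_cst.
    by apply: cvgM; [exact: dnbhs0_cvg0|exact: cvg_cst].
  rewrite mul0r subr0 in h1; apply: near_cvg h1; near=> h.
  have h0 : h != 0 by near: h; exact: nbhs_dnbhs_neq.
  rewrite /y subr0 /GRing.scale /=; field.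
  by rewrite h0 s0.
have de : differentiable (expR : R^o -> R^o) (0 : R^o) by exact/derivable1_diffP/derivable_expR.
have := curve_deriv_comp de dy; rewrite expR0.
suff -> : 'd (expR : R^o -> R^o) (0 : R^o) (x / s ^+ 2) = x / s ^+ 2 by [].
rewrite -[X in 'd _ _ X]mulr1 [LHS]linearZ /= -deriveE//.
have -> : 'D_1 (expR : R^o -> R^o) 0 = 1.
  by rewrite (@derive_val _ _ _ _ _ _ _ (is_derive_expR 0)) expR0.
by rewrite /GRing.scale /= mulr1.
Unshelve. all: end_near. Qed.

(** Both signs follow from [1 + t <= expR t], taken at [- y] when [expR y >= 1] and at [y]
    otherwise. The factor [|y|] supplies the factor [|h|] when the shift density is dominated. *)
Lemma expR_sub1_le (y : R) : `|expR y - 1| <= `|y| * expR `|y|.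
Proof.
have e1 : 1 <= expR `|y| by rewrite -expR0 ler_expR.
have [y0|y0] := leP 0 (expR y - 1).
  rewrite ger0_norm//; apply: (@le_trans _ _ (y * expR y)).
    have := expR_ge1Dx (- y); rewrite expRN => h.
    have := ler_wpM2r (expR_ge0 y) h; rewrite mulVf ?gt_eqF ?expR_gt0// mulrDl mul1r mulNr.
    by lra.
  apply: (@le_trans _ _ (`|y| * expR y)).
    by rewrite ler_wpM2r ?expR_ge0// ler_norm.
  by rewrite ler_wpM2l// ler_expR ler_norm.
rewrite ltr0_norm// opprB; have := expR_ge1Dx y => h.
apply: (@le_trans _ _ `|y|); last by rewrite ler_peMr.
by rewrite -normrN; apply: le_trans (ler_norm _); lra.
Qed.

End shift_density_lemmas.

(** * Exponential moments of the noise *)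

Section exponential_moments.
Context {R : realType} {d : measure_display} {Omega : measurableType d}.
Variables (P : probability Omega R) (M : nat) (B : R -> Omega -> 'rV[R]_M).
Hypothesis B_bm : standard_brownian_motion P B.
Variables (dt : R) (dt0 : 0 < dt) (N : nat).

Definition noise_size (w : Omega) : R :=
  \sum_(k < N) \sum_(j < M) `|increment B dt k w 0 j|.

Lemma noise_size_ge0 w : 0 <= noise_size w.
Proof. by apply: sumr_ge0 => k _; apply: sumr_ge0. Qed.

Lemma coord_le_noise_size k j w : (k < N)%N -> `|increment B dt k w 0 j| <= noise_size w.
Proof.
move=> kN; rewrite /noise_size (bigD1 (Ordinal kN))//= (bigD1 j)//= -addrA lerDl.
by rewrite addr_ge0// sumr_ge0// => ? _; rewrite sumr_ge0.
Qed.

Lemma increment_le_noise_size k w : (k < N)%N -> `|increment B dt k w| <= noise_size w.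
Proof.
move=> kN; apply: rV_normr_le => [|j]; first exact: noise_size_ge0.
exact: coord_le_noise_size.
Qed.

Let exp_moments (f : Omega -> R) :=
  measurable_fun setT (f : Omega -> measurableTypeR R) /\
  forall c, 0 <= c -> P.-integrable setT (EFin \o (fun w => expR (c * f w))).

Let measurable_exp_cM (f : Omega -> R) (c : R) :
  measurable_fun setT (f : Omega -> measurableTypeR R) ->
  measurable_fun setT (fun w => (expR (c * f w))%:E).
Proof.
by move=> mf; apply/measurable_EFinP; apply: measurableT_comp => //; exact: measurable_funM.
Qed.

(** A sum is at most twice its larger term, so [expR (c * (f + g))] is at most
    [expR (2 * c * f) + expR (2 * c * g)]. *)
Lemma exp_momentsD (f g : Omega -> R) : exp_moments f -> exp_moments g ->
  exp_moments (fun w => f w + g w).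
Proof.
move=> [mf ef] [mg eg]; split; first exact: measurable_funD.
move=> c c0; have c2 : 0 <= 2 * c by rewrite mulr_ge0.
apply: (le_integrable measurableT _ _ (integrableD measurableT (ef _ c2) (eg _ c2))).
  by apply: measurable_exp_cM; exact: measurable_funD.
move=> w _ /=; rewrite lee_fin !ger0_norm ?addr_ge0 ?expR_ge0//.
have [fg|gf] := leP (f w) (g w).
  apply: ler_wpDl; first exact: expR_ge0.
  by rewrite ler_expR (mulrC 2) -mulrA ler_wpM2l//; lra.
apply: ler_wpDr; first exact: expR_ge0.
by rewrite ler_expR (mulrC 2) -mulrA ler_wpM2l//; lra.
Qed.

Lemma exp_moments_coord (k : nat) (j : 'I_M) :
  exp_moments (fun w => `|increment B dt k w 0 j|).
Proof.
have mz := measurable_increment B_bm dt0 k j.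
have sdt0 : Num.sqrt dt != 0 by rewrite gt_eqF// sqrtr_gt0.
split; first exact: measurableT_comp.
have Kint h : P.-integrable setT
   (EFin \o (fun w => shift_density (Num.sqrt dt) h (increment B dt k w 0 j))).
  apply/integrableP; split.
    by apply/measurable_EFinP; exact: (measurableT_comp (measurable_shift_density _ _)).
  under eq_integral do rewrite /= ger0_norm ?expR_ge0//.
  (* Cameron-Martin for the constant function 1: the density evaluated at the noise has integral 1,
     hence is integrable. *)
  have := @ge0_cameron_martin_indep R d Omega P (other_noise B dt k j 0) _ _ sdt0
    (@other_noiseI _ _ _ _ B dt k j 0) (@other_noiseT _ _ _ _ B dt k j 0)
    (@other_noise_measurable _ _ _ _ _ _ B_bm dt dt0 k j 0) mz
    (fun E U => @increment_coord_indep _ _ _ _ _ _ B_bm dt dt0 k j 0 E U)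
    (fun=> 1%E) h (@measurable_cst _ _ _ _ _ _) (fun=> lee01).
  under [X in _ = X -> _]eq_integral do rewrite mul1e.
  move=> <-; rewrite integral_cst// mul1e.
  by rewrite (le_lt_trans (probability_le1 P measurableT))// ltry.
(* The shift [h] gives the exponent of the density the slope [c], and [a] cancels its constant term.
   The absolute value is handled by the two shifts [h] and [- h]. *)
move=> c c0; pose h := c * dt; pose a := expR (h ^+ 2 / 2 / dt).
have hE x : expR (c * x) = a * shift_density (Num.sqrt dt) h x.
  rewrite /a /shift_density -expRD sqr_sqrtr ?ltW//; congr expR.
  by rewrite /h; field; rewrite gt_eqF.
have hE' x : expR (- (c * x)) = a * shift_density (Num.sqrt dt) (- h) x.
  rewrite /a /shift_density -expRD sqr_sqrtr ?ltW//; congr expR.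
  by rewrite /h; field; rewrite gt_eqF.
have i1 (h' : R) : P.-integrable setT (EFin \o (fun w => a * shift_density (Num.sqrt dt) h' (increment B dt k w 0 j))).
  rewrite (_ : EFin \o _ = fun w => a%:E * (shift_density (Num.sqrt dt) h' (increment B dt k w 0 j))%:E)%E.
    by apply: integrableZl => //; exact: Kint.
  by apply/funext => w; rewrite /= EFinM.
apply: (le_integrable measurableT _ _ (integrableD measurableT (i1 h) (i1 (- h)))).
  by apply: measurable_exp_cM; exact: measurableT_comp.
move=> w _ /=; rewrite -hE -hE' lee_fin [leLHS]ger0_norm ?expR_ge0//.
rewrite [leRHS]ger0_norm ?addr_ge0 ?expR_ge0//.
have [x0|x0] := leP 0 (increment B dt k w 0 j).
  by rewrite ger0_norm// lerDl expR_ge0.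
by rewrite ltr0_norm// mulrN lerDr expR_ge0.
Qed.

Lemma exp_moments_noise_size : exp_moments noise_size.
Proof.
have e0 : exp_moments (fun=> 0).
  split; first exact: measurable_cst.
  move=> c c0; under eq_fun do rewrite mulr0 expR0.
  exact: finite_measure_integrable_cst.
have sums (n : nat) (f : 'I_n -> Omega -> R) : (forall i, exp_moments (f i)) ->
    exp_moments (fun w => \sum_(i < n) f i w).
  move=> ef; elim: n f ef => [|n IH] f ef.
    by rewrite (_ : (fun w => _) = fun=> 0)//; apply/funext => w; rewrite big_ord0.
  rewrite (_ : (fun w => _) = fun w => \sum_(i < n) f (widen_ord (leqnSn n) i) w + f ord_max w).
    by apply: exp_momentsD => //; exact: IH.
  by apply/funext => w; rewrite big_ord_recr.
by apply: (sums N) => k; apply: sums => j; exact: exp_moments_coord.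
Qed.

Lemma integrable_exp_bounded (A : set Omega) (f : Omega -> R) :
  {ae P, forall w, A w} -> measurable_fun setT (f : Omega -> measurableTypeR R) ->
  exp_bounded A noise_size f -> P.-integrable setT (EFin \o f).
Proof.
move=> aeA mf [c c0 fc].
have mfE : measurable_fun setT (EFin \o f) by exact/measurable_EFinP.
have ig : P.-integrable setT (EFin \o (fun w => expR (c * (1 + noise_size w)))).
  rewrite (_ : EFin \o _ = fun w => (expR c)%:E * (expR (c * noise_size w))%:E)%E.
    by apply: integrableZl => //; exact: (exp_moments_noise_size.2 c c0).
  by apply/funext => w; rewrite /= mulrDr mulr1 expRD EFinM.
apply/integrableP; split => //.
have /integrableP[mg] := ig; apply: le_lt_trans.
apply: ae_ge0_le_integral => //.
- exact: measurableT_comp.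
- exact: measurableT_comp.
- by apply: filterS aeA => w Aw _ /=; rewrite lee_fin [leRHS]ger0_norm ?expR_ge0 ?fc.
Qed.

End exponential_moments.

(** * Gaussian integration by parts *)

Section gaussian_integration_by_parts.
Context {R : realType} {d : measure_display} {Omega : measurableType d}.
Variables (P : probability Omega R) (M : nat) (B : R -> Omega -> 'rV[R]_M).
Hypothesis B_bm : standard_brownian_motion P B.
Variables (dt : R) (dt0 : 0 < dt) (N : nat).
Variables (A : set Omega) (aeA : {ae P, forall w, A w}).

Let S := noise_size B dt N.
Let S0 w : 0 <= S w := noise_size_ge0 B dt N w.

Lemma curve_deriv_expectation_exp (r : R) (f : R -> Omega -> R) (f0 f' G : Omega -> R^o) :
  0 < r ->
  (forall h, `|h| < r -> measurable_fun setT (f h : Omega -> measurableTypeR R)) ->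
  measurable_fun setT (f0 : Omega -> measurableTypeR R) ->
  exp_bounded A S f0 -> exp_bounded A S G ->
  (forall h w, A w -> `|h| < r -> `|f h w - f0 w| <= `|h| * G w) ->
  (forall w, curve_deriv (f ^~ w : R -> R^o) (f0 w) (f' w)) ->
  [/\ forall h, `|h| < r -> P.-integrable setT (EFin \o f h),
      P.-integrable setT (EFin \o f')
    & curve_deriv (fun h => \int[P]_w f h w : R^o) (\int[P]_w f0 w) (\int[P]_w f' w)].
Proof.
move=> r0 mf mf0 bf0 bG fG ff'.
have ifh h : `|h| < r -> P.-integrable setT (EFin \o f h).
  move=> hr; apply: (integrable_exp_bounded B_bm dt0 aeA (mf _ hr)).
  have b1 : exp_bounded A S (fun w => f h w - f0 w).
    apply: (exp_bounded_le (exp_boundedZ S0 `|h| bG)) => w Aw.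
    by apply: le_trans (fG _ _ Aw hr) _; rewrite ler_norm.
  apply: (exp_bounded_le (exp_boundedD S0 b1 bf0)) => w _.
  by rewrite subrK.
have [c c0 Gc] := bG.
have mS : measurable_fun setT (S : Omega -> measurableTypeR R).
  exact: (exp_moments_noise_size B_bm dt0 N).1.
(* [G] comes with no measurability, so its exponential bound takes over as the dominating
   function. *)
pose G' w := expR (c * (1 + S w)).
have iG' : P.-integrable setT (EFin \o G').
  apply: (integrable_exp_bounded (A := A) (N := N) B_bm dt0) => //.
    apply: measurableT_comp => //; apply: measurable_funM => //.
    exact: measurable_funD.
  by exists c => // w _; rewrite ger0_norm ?expR_ge0.
have fG' : {ae P, forall w, forall h, `|h| < r -> `|f h w - f0 w| <= `|h| * G' w}.
  apply: filterS aeA => w Aw h hr; apply: le_trans (fG _ _ Aw hr) _.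
  by rewrite ler_wpM2l// (le_trans (ler_norm _))// Gc.
have if0 := integrable_exp_bounded B_bm dt0 aeA mf0 bf0.
have [if' cf] := curve_deriv_expectation r0 ifh if0 iG' ff' fG'.
by split.
Qed.

Variables (n : nat) (i : 'I_M) (nN : (n < N)%N).
Let z w : R := increment B dt n w 0 i.
Let s := Num.sqrt dt.
Let OmegaK := g_sigma_algebraType (other_noise B dt n i N).

Let s0 : s != 0. Proof. by rewrite gt_eqF// sqrtr_gt0. Qed.

Let mz : measurable_fun setT (z : Omega -> measurableTypeR R).
Proof. exact: (measurable_increment B_bm dt0 n i). Qed.

Lemma measurable_other_noise_id :
  measurable_fun setT (fun w : Omega => w : OmegaK).
Proof.
move=> _ U KU; rewrite setTI.
apply: (smallest_sub _ (@other_noise_measurable _ _ _ _ _ _ B_bm dt dt0 n i N)) KU.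
exact: sigma_algebra_measurable.
Qed.

(** Independence enters through the type of [H]: its first argument sees only the other noise, so
    the shifted coordinate acts through the second argument alone. *)
Lemma gaussian_ibp (H : OmegaK * measurableTypeR R -> R) (r : R) (f' G : Omega -> R^o) :
  measurable_fun setT (H : _ -> measurableTypeR R) -> 0 < r -> r <= 1 ->
  exp_bounded A S (fun w => H (w, z w)) -> exp_bounded A S G ->
  (forall h w, A w -> `|h| < r -> `|H (w, z w + h) - H (w, z w)| <= `|h| * G w) ->
  (forall w, curve_deriv (fun h => H (w, z w + h) : R^o) (H (w, z w)) (f' w)) ->
  [/\ P.-integrable setT (EFin \o f'),
      P.-integrable setT (EFin \o (fun w => H (w, z w) * (z w / dt)))
    & \int[P]_w f' w = \int[P]_w (H (w, z w) * (z w / dt))].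
Proof.
move=> mH r0 r1 bH bG HG Hf'.
have mHh h : measurable_fun setT (fun w => H (w, z w + h) : measurableTypeR R).
  apply: (measurableT_comp mH); apply: measurable_fun_pair.
    exact: measurable_other_noise_id.
  exact: measurable_funD.
have mH0 : measurable_fun setT (fun w => H (w, z w) : measurableTypeR R).
  by apply: (measurableT_comp mH); apply: measurable_fun_pair => //; exact: measurable_other_noise_id.
have sdt : s ^+ 2 = dt by rewrite sqr_sqrtr// ltW.
have bz : exp_bounded A S z.
  apply: (exp_bounded_le (exp_bounded_weight A S0)) => w _.
  by rewrite [leRHS]ger0_norm// coord_le_noise_size.
have [_ if' cf] := @curve_deriv_expectation_exp r (fun h w => H (w, z w + h))
  (fun w => H (w, z w)) f' G r0 (fun h _ => mHh h) mH0 bH bG HG Hf'.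
(* For [|h| <= 1] the exponent of [shift_density s h (z w)] is at most [|h| * D w] in absolute
   value; [expR_sub1_le] then leads to [G2]. *)
pose D w := (`|z w| + 1) / dt.
have D0 w : 0 <= D w by rewrite divr_ge0 ?addr_ge0 ?(ltW dt0)//.
pose G2 w := `|H (w, z w)| * (D w * expR (D w)).
have dbound h x : `|h| <= 1 -> `|shift_density s h x - 1| <=
    `|h| * ((`|x| + 1) / dt * expR ((`|x| + 1) / dt)).
  move=> h1; apply: le_trans (expR_sub1_le _) _.
  have yh : `|(h * x - h ^+ 2 / 2) / s ^+ 2| <= `|h| * ((`|x| + 1) / dt).
    have dti : 0 <= dt^-1 by rewrite invr_ge0 ltW.
    rewrite sdt normrM (ger0_norm dti) [leRHS]mulrA; apply: ler_wpM2r => //.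
    apply: le_trans (ler_normB _ _) _; rewrite mulrDr normrM lerD2l.
    rewrite expr2 -mulrA normrM ler_wpM2l// normrM (ger0_norm (_ : 0 <= 2^-1))//.
    by lra.
  have xd0 : 0 <= (`|x| + 1) / dt by rewrite divr_ge0 ?addr_ge0 ?(ltW dt0)//.
  rewrite mulrA ler_pM ?expR_ge0// ler_expR (le_trans yh)//.
  by rewrite ler_piMl.
have mg h : measurable_fun setT (fun w => H (w, z w) * shift_density s h (z w) : measurableTypeR R).
  by apply: measurable_funM => //; exact: (measurableT_comp (measurable_shift_density _ _)).
have bD : exp_bounded A S D.
  rewrite /D; apply: exp_boundedM; last exact: exp_bounded_cst.
  by apply: exp_boundedD => //; [exact: exp_bounded_norm|exact: exp_bounded_cst].
(* This factor grows exponentially in the noise, which is why domination is by exponentials rather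
   than polynomials. *)
have beD : exp_bounded A S (fun w => expR (D w)).
  exists (1 / dt); first by rewrite divr_ge0// ltW.
  move=> w _; rewrite ger0_norm ?expR_ge0// ler_expR /D mul1r [leRHS]mulrC.
  apply: ler_wpM2r; first by rewrite invr_ge0 ltW.
  by rewrite addrC lerD2l coord_le_noise_size.
have bG2 : exp_bounded A S G2.
  by apply: exp_boundedM; [exact: exp_bounded_norm|exact: exp_boundedM].
have gG2 h w : A w -> `|h| < r ->
    `|H (w, z w) * shift_density s h (z w) - H (w, z w)| <= `|h| * G2 w.
  move=> _ hr; rewrite -{2}[H (w, z w)]mulr1 -mulrBr normrM mulrCA ler_wpM2l//.
  by apply: dbound; rewrite ltW// (lt_le_trans hr).
have dg w : curve_deriv (fun h => H (w, z w) * shift_density s h (z w) : R^o)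
    (H (w, z w) : R^o) (H (w, z w) * (z w / dt)).
  have := curve_derivZ (a := H (w, z w)) (@curve_deriv_shift_density _ _ s0 (z w)).
  by rewrite sdt /GRing.scale /= mulr1.
have [_ ig' cg] := @curve_deriv_expectation_exp r
  (fun h w => H (w, z w) * shift_density s h (z w)) (fun w => H (w, z w))
  (fun w => H (w, z w) * (z w / dt)) G2 r0 (fun h _ => mg h) mH0 bH bG2 gG2 dg.
split=> //.
have cm h : \int[P]_w H (w, z w + h) = \int[P]_w (H (w, z w) * shift_density s h (z w)).
  rewrite /Rintegral; congr fine.
  exact: (@cameron_martin_indep _ _ _ P (other_noise B dt n i N) z s s0
    (@other_noiseI _ _ _ _ B dt n i N) (@other_noiseT _ _ _ _ B dt n i N)
    (@other_noise_measurable _ _ _ _ _ _ B_bm dt dt0 n i N) mz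
    (fun E U => @increment_coord_indep _ _ _ _ _ _ B_bm dt dt0 n i N E U) H h mH).
(* By [cm] the two curves of expectations coincide, so their derivatives at 0 do too. *)
apply: (cvg_unique _ cf); first exact: norm_hausdorff.
apply: near_cvg cg; apply: nearW => h /=; by rewrite cm.
Qed.

End gaussian_integration_by_parts.

(** * Damped tangent process *)

Section damped_tangent.
Context {R : realType} {M : nat}.
Variables (f df : 'rV[R]_M -> 'rV[R]_M) (s ds : 'rV[R]_M -> R^o) (dt : R).
Variables (x0 v0 : 'rV[R]_M).

Fixpoint damped_tangent (a : nat -> R) (xi : nat -> 'rV[R]_M) (n : nat) : 'rV[R]_M :=
  if n is k.+1 then
    let x := euler_map f s dt xi x0 k in
    let v := damped_tangent a xi k in
    v - (a k * dt) *: v + dt *: ('d f x v + df x) + ('d s x v + ds x : R^o) *: xi k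
  else v0.

Definition unit_shift (n : nat) (i : 'I_M) (k : nat) : 'rV[R]_M :=
  if k == n then 'e_i else 0.

Definition damping_weight (a : nat -> R) (xi : nat -> 'rV[R]_M) (n : nat) (i : 'I_M) : R :=
  a n * dt * damped_tangent a xi n 0 i / s (euler_map f s dt xi x0 n).

(** Only the shifts of increment [m] act at step [m]; there the diffusion coefficient cancels the
    denominator of the weights, and the coordinates of the damped tangent reassemble. *)
Lemma sum_damping_weight a xi N m : (m < N)%N -> s (euler_map f s dt xi x0 m) != 0 ->
  \sum_(p : 'I_N * 'I_M) damping_weight a xi p.1 p.2 *:
     (s (euler_map f s dt xi x0 m) *: unit_shift p.1 p.2 m) =
  (a m * dt) *: damped_tangent a xi m.
Proof.
move=> mN s0.
pose G (n : 'I_N) (i : 'I_M) :=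
  damping_weight a xi n i *: (s (euler_map f s dt xi x0 m) *: unit_shift n i m).
rewrite -(pair_bigA _ G) /= /G.
rewrite (bigD1 (Ordinal mN))//= [X in _ + X]big1 ?addr0; last first.
  move=> n; rewrite -val_eqE /= => nm; apply: big1 => i _.
  by rewrite /unit_shift eq_sym (negbTE nm) !scaler0.
rewrite [in RHS](rV_delta_sum (damped_tangent a xi m)) scaler_sumr.
apply: eq_bigr => i _; rewrite /unit_shift eqxx !scalerA; congr (_ *: _).
by rewrite /damping_weight divfK.
Qed.

(** The sum ranges over all increments even when [m < N]: a shift of an increment not yet used has
    zero derivative, and the fixed index set lets the induction keep one formula. *)
Lemma tangent_decomposition a xi N m : (m <= N)%N ->
  (forall x, s x != 0) ->
  tangent_map f df s ds dt xi (fun=> 0) x0 v0 m =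
  damped_tangent a xi m +
  \sum_(p : 'I_N * 'I_M) damping_weight a xi p.1 p.2 *:
     tangent_map f (fun=> 0) s (fun=> 0) dt xi (unit_shift p.1 p.2) x0 0 m.
Proof.
move=> + s0; elim: m => [|m IH] mN.
  by rewrite /= big1 ?addr0// => p _; rewrite scaler0.
rewrite [LHS]/= (IH (ltnW mN)) scaler0 add0r.
set X := euler_map f s dt xi x0 m.
set V := damped_tangent a xi m.
pose D (p : 'I_N * 'I_M) := tangent_map f (fun=> 0) s (fun=> 0) dt xi (unit_shift p.1 p.2) x0 0 m.
rewrite -/(\sum_(p : 'I_N * 'I_M) damping_weight a xi p.1 p.2 *: D p).
set Q := \sum_(p : 'I_N * 'I_M) _ *: D p.
(* The weights do not change with [m], so [Q] follows the linear recursion of the shift derivatives,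
   with the source computed by [sum_damping_weight]. *)
have -> : \sum_(p : 'I_N * 'I_M) damping_weight a xi p.1 p.2 *:
     tangent_map f (fun=> 0) s (fun=> 0) dt xi (unit_shift p.1 p.2) x0 0 m.+1 =
   Q + dt *: 'd f X Q + ((a m * dt) *: V + ('d s X Q : R^o) *: xi m).
  rewrite -(@sum_damping_weight a xi N m mN (s0 _)) -/X /Q !linear_sum /= ?scaler_sumr scaler_suml.
  rewrite -!big_split /=; apply: eq_bigr => p _.
  rewrite -/(D p) -/X !addr0 !linearZ /= !scalerDr !scalerA.
  by rewrite [s X * _]mulrC.
rewrite [damped_tangent a xi m.+1]/= -/X -/V.
have -> : 'd f X (V + Q) = 'd f X V + 'd f X Q by rewrite linearD.
have -> : 'd s X (V + Q) = 'd s X V + 'd s X Q by rewrite linearD.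
by apply/rowP => j; rewrite !mxE; ring.
Qed.

End damped_tangent.

Section measurable_euler.
Context {R : realType} {d : measure_display} {T : measurableType d} {M : nat}.
Variables (f df : 'rV[R]_M -> 'rV[R]_M) (s ds : 'rV[R]_M -> R^o) (dt : R).
Variables (x0 v0 : 'rV[R]_M) (xi : nat -> T -> 'rV[R]_M) (N : nat).
Hypothesis mxi : forall k, (k < N)%N -> measurable_rV (xi k).

(** The measurable space is arbitrary because three are needed: [Omega], its copy [OmegaK] with
    fewer measurable sets, and the product of [OmegaK] with the line. *)
Lemma measurable_euler_map n : continuous f -> continuous s -> (n <= N)%N ->
  measurable_rV (fun w => euler_map f s dt (xi ^~ w) x0 n).
Proof.
move=> cf cs; elim: n => [|n IH] nN /=; first exact: measurable_rV_cst.
have {}IH := IH (ltnW nN).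
apply: measurable_rVD.
  apply: measurable_rVD => //; apply: measurable_rVZ; first exact: measurable_cst.
  exact: measurable_rV_comp.
by apply: measurable_rVZ; [exact: measurable_fun_comp_rV|exact: mxi].
Qed.

Variable a : nat -> T -> R.
Hypothesis ma : forall k, (k < N)%N -> measurable_fun setT (a k : T -> measurableTypeR R).

Lemma measurable_damped_tangent n :
  (forall x, differentiable f x) -> (forall x, differentiable s x) ->
  continuous df -> continuous ds -> (n <= N)%N ->
  measurable_rV (fun w => damped_tangent f df s ds dt x0 v0 (a ^~ w) (xi ^~ w) n).
Proof.
move=> Df Ds cdf cds; elim: n => [|n IH] nN /=; first exact: measurable_rV_cst.
have {}IH := IH (ltnW nN).
have cf : continuous f by move=> x; exact: differentiable_continuous.
have cs : continuous s by move=> x; exact: differentiable_continuous.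
have mX := measurable_euler_map cf cs (ltnW nN).
apply: measurable_rVD; last first.
  apply: measurable_rVZ; last exact: mxi.
  by apply: measurable_funD; [exact: measurable_diff|exact: measurable_fun_comp_rV].
apply: measurable_rVD; last first.
  apply: measurable_rVZ; first exact: measurable_cst.
  by apply: measurable_rVD; [exact: measurable_rV_diff|exact: measurable_rV_comp].
have -> : (fun w => damped_tangent f df s ds dt x0 v0 (a ^~ w) (xi ^~ w) n -
    (a n w * dt) *: damped_tangent f df s ds dt x0 v0 (a ^~ w) (xi ^~ w) n) =
  (fun w => damped_tangent f df s ds dt x0 v0 (a ^~ w) (xi ^~ w) n +
    (- (a n w * dt)) *: damped_tangent f df s ds dt x0 v0 (a ^~ w) (xi ^~ w) n).
  by apply/funext => w; rewrite scaleNr.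
apply: measurable_rVD => //; apply: measurable_rVZ => //.
by apply: measurable_funN; apply: measurable_funM => //; exact: ma.
Qed.

End measurable_euler.

Section damped_tangent_bound.
Context {R : realType} {M : nat} {T : Type}.
Variables (A : set T) (S : T -> R) (S0 : forall w, 0 <= S w).
Variables (dt : R) (xi : nat -> T -> 'rV[R]_M) (N : nat).
Hypothesis xiS : forall k w, (k < N)%N -> `|xi k w| <= S w.
Variables (f df : 'rV[R]_M -> 'rV[R]_M) (s ds : 'rV[R]_M -> R^o).
Variables (L : R) (L0 : 0 <= L).
Hypotheses (ff : smooth_family (fun=> f) (fun=> 0) 1 L).
Hypotheses (fs : smooth_family (fun=> s) (fun=> 0) 1 L).
Hypotheses (dfL : forall x, `|df x| <= L * (1 + `|x|)).
Hypotheses (dsL : forall x, `|ds x| <= L * (1 + `|x|)).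
Variables (x0 v0 : 'rV[R]_M) (a : nat -> T -> R) (astar : R).
Hypothesis aA : forall k w, (k < N)%N -> A w -> `|a k w| <= astar.

Lemma exp_bounded_damped_tangent n : (n <= N)%N ->
  exp_bounded A S
    (fun w => `|damped_tangent f df s ds dt x0 v0 (a ^~ w) (xi ^~ w) n|).
Proof.
elim: n => [|n IH] nN /=; first exact: exp_bounded_cst.
have {}IH := IH (ltnW nN).
have bX : exp_bounded A S (fun w => `|euler_map f s dt (xi ^~ w) x0 n|).
  exact: (exp_bounded_family_euler A S0 dt xiS ltr01 L0 ff fs x0 (ltnW nN)).
have ba : exp_bounded A S (a n).
  apply: (exp_bounded_le (exp_bounded_cst A S0 astar)) => w Aw.
  by apply: le_trans (aA nN Aw) _; exact: ler_norm.
have bL (V : normedModType R) (g dg : 'rV[R]_M -> V) :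
    smooth_family (fun=> g) (fun=> 0) 1 L -> (forall x, `|dg x| <= L * (1 + `|x|)) ->
    exp_bounded A S (fun w =>
      `|'d g (euler_map f s dt (xi ^~ w) x0 n)
          (damped_tangent f df s ds dt x0 v0 (a ^~ w) (xi ^~ w) n) +
        dg (euler_map f s dt (xi ^~ w) x0 n)|).
  move=> fg dgL; apply: exp_bounded_normD => //.
    apply: (exp_bounded_le (exp_boundedZ S0 L IH)) => w _.
    by rewrite normr_id; apply: le_trans (family_derive_le ltr01 fg _ _) _; exact: ler_norm.
  apply: (@exp_bounded_linear_growth _ _ _ A S S0 _ dg L L) => // x.
  by rewrite -[X in X + _]mulr1 -mulrDr.
apply: exp_bounded_normD => //; last first.
  apply: exp_bounded_normZ; last exact: (exp_bounded_xi A S0 xiS nN).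
  have := bL _ s ds fs dsL => h; apply: (exp_bounded_le h) => w _.
  by rewrite normr_id.
apply: exp_bounded_normD => //; last first.
  by apply: exp_bounded_normZ; [exact: exp_bounded_cst|exact: bL].
apply: exp_bounded_normD => //.
have h : exp_bounded A S (fun w => `|(a n w * dt) *: damped_tangent f df s ds dt x0 v0 (a ^~ w) (xi ^~ w) n|).
  by apply: exp_bounded_normZ => //; apply: exp_boundedM => //; exact: exp_bounded_cst.
by apply: (exp_bounded_le h) => w _; rewrite normrN.
Qed.

End damped_tangent_bound.

(** * Integration by parts for one damping weight *)

Section damping_integration_by_parts.
Context {R : realType} {d : measure_display} {Omega : measurableType d}.
Variables (P : probability Omega R) (M : nat) (B : R -> Omega -> 'rV[R]_M).
Hypothesis B_bm : standard_brownian_motion P B.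
Variables (dt : R) (dt0 : 0 < dt) (N : nat).
Variables (A : set Omega) (aeA : {ae P, forall w, A w}).
Variables (f df : 'rV[R]_M -> 'rV[R]_M) (s ds : 'rV[R]_M -> R^o).
Variables (L : R) (L0 : 0 <= L).
Hypotheses (ff : smooth_family (fun=> f) (fun=> 0) 1 L).
Hypotheses (fs : smooth_family (fun=> s) (fun=> 0) 1 L).
Hypotheses (cdf : continuous df) (cds : continuous ds).
Hypotheses (dfL : forall x, `|df x| <= L * (1 + `|x|)).
Hypotheses (dsL : forall x, `|ds x| <= L * (1 + `|x|)).
Variables (sstar : R) (sstar0 : 0 < sstar) (s_lb : forall x, sstar <= `|s x|).
Variables (Phi : 'rV[R]_M -> R^o).
Hypotheses (dPhi : forall x, differentiable Phi x).
Hypotheses (PhiL : forall x y, `|Phi x - Phi y| <= L * `|x - y|).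
Variables (x0 v0 : 'rV[R]_M) (a : nat -> Omega -> R) (astar : R).
Hypothesis aA : forall k w, (k < N)%N -> A w -> `|a k w| <= astar.
Hypothesis a_adapted : forall k (U : set (measurableTypeR R)), (k < N)%N ->
  measurable U -> natural_filtration B (k%:R * dt) (a k @^-1` U).

Let S := noise_size B dt N.
Let S0 w : 0 <= S w := noise_size_ge0 B dt N w.
Let xi k w := increment B dt k w.
Let xiS k w (kN : (k < N)%N) : `|xi k w| <= S w := increment_le_noise_size B dt w kN.

Variables (n : nat) (i : 'I_M) (nN : (n < N)%N).

Let OmegaK := g_sigma_algebraType (other_noise B dt n i N).
Let X w m := euler_map f s dt (xi ^~ w) x0 m.
Let weight w := damping_weight f df s ds dt x0 v0 (a ^~ w) (xi ^~ w) n i.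

Let measurableK (g : Omega -> R) :
  (forall U : set (measurableTypeR R), measurable U -> other_noise B dt n i N (g @^-1` U)) ->
  measurable_fun setT (g : OmegaK -> measurableTypeR R).
Proof. by move=> Kg _ U mU; rewrite setTI; apply: sub_sigma_algebra; exact: Kg. Qed.

Let measurableK_past k : (k < n)%N -> @measurable_rV _ _ OmegaK _ (xi k).
Proof.
move=> kn j; apply: (measurableK (g := fun w => xi k w 0 j)) => U mU.
apply: other_noise_past.
by have := @measurable_increment_filtration _ _ _ _ B dt dt0 k n j kn measurableT U mU; rewrite setTI.
Qed.

Let measurableK_future k : (n < k < N)%N -> @measurable_rV _ _ OmegaK _ (xi k).
Proof.
move=> /andP[nk kN] j; apply: (measurableK (g := fun w => xi k w 0 j)) => U mU.
(* [other_noise] numbers the increments after the [n]-th from zero. *)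
have kE : k = (n.+1 + (k - n.+1))%N by rewrite subnKC.
apply: (@other_noise_future _ _ _ _ B dt n i N (k - n.+1)).
  by apply: leq_ltn_trans kN; exact: leq_subr.
by rewrite -kE; exact: (sigma_rvec_preimage (X := increment B dt k)).
Qed.

Let measurableK_coord j : j != i ->
  measurable_fun setT (fun w : OmegaK => xi n w 0 j : measurableTypeR R).
Proof.
move=> ji; apply: (measurableK (g := fun w => xi n w 0 j)) => U mU.
exact: (other_noise_coord B dt n N ji mU).
Qed.

Let measurableK_a k : (k <= n)%N -> measurable_fun setT (a k : OmegaK -> measurableTypeR R).
Proof.
move=> kn; apply: measurableK => U mU; apply: other_noise_past.
apply: natural_filtration_mono (a_adapted (leq_ltn_trans kn nN) mU).
by apply: ler_wpM2r; [exact: ltW|rewrite ler_nat].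
Qed.

Let cf : continuous f.
Proof. by move=> x; apply: differentiable_continuous; exact: (family_diff ff). Qed.
Let cs : continuous s.
Proof. by move=> x; apply: differentiable_continuous; exact: (family_diff fs). Qed.

Let s_neq0 x : s x != 0.
Proof. by rewrite -normr_gt0 (lt_le_trans sstar0). Qed.

Let cinvs : continuous (fun x => (s x)^-1 : R^o).
Proof. by move=> x; exact: (@cvgV R _ (nbhs x) _ s (s x) (s_neq0 x) (@cs x)). Qed.

(** The weight reads increments before step [n] and damping values up to [a n], and adaptedness
    places the latter in the past of the [n]-th increment as well. *)
Let measurableK_weight : measurable_fun setT (weight : OmegaK -> measurableTypeR R).
Proof.
have mv : @measurable_rV _ _ OmegaK _
    (fun w => damped_tangent f df s ds dt x0 v0 (a ^~ w) (xi ^~ w) n).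
  have ma k (kn : (k < n)%N) := measurableK_a (ltnW kn).
  exact: (@measurable_damped_tangent _ _ OmegaK _ f df s ds dt x0 v0 xi n measurableK_past
    a ma n (family_diff ff) (family_diff fs) cdf cds (leqnn n)).
have mX : @measurable_rV _ _ OmegaK _ (fun w => X w n).
  exact: (@measurable_euler_map _ _ OmegaK _ f s dt x0 xi n measurableK_past n cf cs (leqnn n)).
rewrite /weight /damping_weight; apply: measurable_funM; last first.
  exact: (measurable_fun_comp_rV (f := fun x => (s x)^-1 : R^o)).
apply: measurable_funM; last exact: mv.
by apply: measurable_funM => //; exact: measurableK_a.
Qed.

Let bounded_weight : exp_bounded A S weight.
Proof.
have bv := exp_bounded_damped_tangent S0 dt xiS L0 ff fs dfL dsL x0 v0 aA (ltnW nN).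
rewrite /weight /damping_weight; apply: exp_boundedM; last first.
  apply: (exp_bounded_le (exp_bounded_cst A S0 sstar^-1)) => w _.
  rewrite normfV [leRHS]ger0_norm; last by rewrite invr_ge0 ltW.
  rewrite lef_pV2 ?posrE//.
  exact: lt_le_trans sstar0 _.
apply: exp_boundedM; last first.
  by apply: (exp_bounded_le bv) => w _; rewrite normr_id; exact: rV_normr_coord.
apply: exp_boundedM; last exact: exp_bounded_cst.
apply: (exp_bounded_le (exp_bounded_cst A S0 astar)) => w Aw.
by apply: le_trans (aA nN Aw) _; exact: ler_norm.
Qed.

Let zeta w : R := xi n w 0 i.
(** The noise with its distinguished coordinate read from the second component; at [(w, zeta w)] it
    is the original noise. *)
Let xi' k (z : OmegaK * measurableTypeR R) : 'rV[R]_M :=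
  if k == n then \row_j (if j == i then z.2 else xi n z.1 0 j) else xi k z.1.
(** The weight takes [z.1] only, so a shift of the second component differentiates [Phi] and leaves
    the weight frozen. *)
Let H (z : OmegaK * measurableTypeR R) : R :=
  Phi (euler_map f s dt (xi' ^~ z) x0 N) * weight z.1.

Let xi'E k w h : xi' k (w, zeta w + h) = xi k w + h *: unit_shift n i k.
Proof.
rewrite /xi' /unit_shift /=; case: eqP => [->|_]; last by rewrite scaler0 addr0.
apply/rowP => j; rewrite [LHS]mxE [RHS]mxE [X in _ = _ + X]mxE [X in _ = _ + _ * X]mxE eqxx /=.
by case: eqP => [->|_]; rewrite ?mulr1 ?mulr0 ?addr0.
Qed.

Let HE w h : H (w, zeta w + h) =
  Phi (euler_map f s dt (fun k => xi k w + h *: unit_shift n i k) x0 N) * weight w.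
Proof.
rewrite /H /=; congr (Phi (euler_map f s dt _ x0 N) * _).
by apply/funext => k; exact: xi'E.
Qed.

Let HE0 w : H (w, zeta w) = Phi (X w N) * weight w.
Proof.
rewrite -[zeta w]addr0 HE; congr (Phi (euler_map f s dt _ x0 N) * _).
by apply/funext => k; rewrite scale0r addr0.
Qed.

Let mH : measurable_fun setT (H : _ -> measurableTypeR R).
Proof.
have mfst (g : OmegaK -> R) : measurable_fun setT (g : OmegaK -> measurableTypeR R) ->
    measurable_fun setT (fun z : OmegaK * measurableTypeR R => g z.1 : measurableTypeR R).
  by move=> mg; exact: (measurableT_comp mg).
apply: measurable_funM; last exact: mfst.
apply: measurable_fun_comp_rV.
  by move=> x; exact: differentiable_continuous.
apply: (@measurable_euler_map _ _ (OmegaK * measurableTypeR R)%type _ f s dt x0 xi' N _ N cf cs (leqnn N)) => k kN.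
rewrite /xi'; case: ltngtP => [kn|nk|_].
- by move=> j; apply: (mfst (fun w => xi k w 0 j)); exact: measurableK_past.
- by move=> j; apply: (mfst (fun w => xi k w 0 j)); apply: measurableK_future; rewrite nk kN.
- move=> j; rewrite (_ : (fun w => _) = fun z : OmegaK * measurableTypeR R =>
      if j == i then z.2 else xi n z.1 0 j); last by apply/funext => z; rewrite mxE.
  have [_|ji] := eqVneq j i; first exact: measurable_snd.
  by apply: (mfst (fun w => xi n w 0 j)); exact: measurableK_coord.
Qed.

Lemma weight_ibp :
  [/\ P.-integrable setT (EFin \o (fun w => weight w *
        'd Phi (X w N) (tangent_map f (fun=> 0) s (fun=> 0) dt (xi ^~ w) (unit_shift n i) x0 0 N))),
      P.-integrable setT (EFin \o (fun w => Phi (X w N) * weight w * (zeta w / dt)))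
    & \int[P]_w (weight w *
        'd Phi (X w N) (tangent_map f (fun=> 0) s (fun=> 0) dt (xi ^~ w) (unit_shift n i) x0 0 N)) =
      \int[P]_w (Phi (X w N) * weight w * (zeta w / dt))].
Proof.
have [G G0 [bG GX]] := @euler_difference_bound _ _ _ A S S0 dt xi N xiS _ _ _ _ 1 L
  ltr01 (lexx 1) L0 ff fs x0 0 (unit_shift n i) N (leqnn N).
have bX : exp_bounded A S (fun w => `|X w N|).
  exact: (exp_bounded_family_euler A S0 dt xiS ltr01 L0 ff fs x0 (leqnn N)).
have bPhi : exp_bounded A S (fun w => Phi (X w N)).
  have h := exp_bounded_linear_growth S0 (normr_ge0 (Phi 0)) L0 (lipschitz_growth PhiL) bX.
  by apply: (exp_bounded_le h) => w _; rewrite normr_id.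
pose D w := tangent_map f (fun=> 0) s (fun=> 0) dt (xi ^~ w) (unit_shift n i) x0 0 N.
pose f' w : R^o := weight w * 'd Phi (X w N) (D w).
pose G' w := L * G w * `|weight w|.
have bG' : exp_bounded A S G'.
  by apply: exp_boundedM; [exact: exp_boundedZ|exact: exp_bounded_norm].
have bH : exp_bounded A S (fun w => H (w, zeta w)).
  by apply: (exp_bounded_le (exp_boundedM bPhi bounded_weight)) => w _; rewrite HE0.
have HG h w : A w -> `|h| < 1 -> `|H (w, zeta w + h) - H (w, zeta w)| <= `|h| * G' w.
  move=> Aw h1; rewrite HE HE0 -mulrBl normrM /G' mulrA ler_wpM2r//.
  apply: le_trans (PhiL _ _) _; rewrite mulrCA ler_wpM2l//.
  by have := GX h w Aw h1; rewrite scaler0 addr0.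
have dH w : curve_deriv (fun h => H (w, zeta w + h) : R^o) (H (w, zeta w) : R^o) (f' w).
  (* The general perturbation also moves the start; here its direction is 0. *)
  have h1 : curve_deriv (fun h => euler_map f s dt (fun k => xi k w + h *: unit_shift n i k)
      (x0 + h *: 0) N) (X w N) (D w).
    exact: (@euler_map_curve_deriv R M (fun=> f) (fun=> 0) (fun=> s) (fun=> 0) 1 L ltr01
      ff fs dt x0 0 (unit_shift n i) (xi ^~ w) N).
  have h2 := curve_derivZ (a := weight w) (curve_deriv_comp (dPhi _) h1).
  rewrite HE0 mulrC; apply: near_cvg h2; apply: nearW => h /=.
  by rewrite HE scaler0 addr0 [X in _ = _ *: (X - _)]mulrC.
have [h1 h2 h3] := @gaussian_ibp _ _ _ P M B B_bm dt dt0 N A aeA n i nN H 1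
  f' G' mH ltr01 (lexx 1) bH bG' HG dH.
have HE0' : (fun w => H (w, zeta w) * (zeta w / dt)) =
    (fun w => Phi (X w N) * weight w * (zeta w / dt)).
  by apply/funext => w; rewrite HE0.
by split; [exact: h1|rewrite -HE0'; exact: h2|rewrite -HE0'; exact: h3].
Qed.

End damping_integration_by_parts.

(** Lets the perturbation lemmas apply when only the noise moves. *)
Lemma smooth_family_cst {R : realType} {M : nat} {V : normedModType R}
    (f : 'rV[R]_M -> V) (L : R) : 0 <= L ->
  (forall x, differentiable f x) -> (forall x y, `|f x - f y| <= L * `|x - y|) ->
  smooth_family (fun=> f) (fun=> 0) 1 L.
Proof.
move=> L0 df fL; split => //.
- by move=> h x y _; rewrite !subrr normr0 !mulr_ge0.
- by move=> h x _; rewrite subrr normr0 !mulr_ge0// addr_ge0.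
- by move=> x; exact: curve_deriv_cst.
Qed.

(** * Identification of the schemes and assembly of the formula *)

Section euler_identification.
Context {R : realType} {Omega : Type} {M : nat}.
Variables (F dF : R -> 'rV[R]_M -> 'rV[R]_M) (sigma dsigma : R -> 'rV[R]_M -> R^o).
Variables (alpha : R -> Omega -> R) (B : R -> Omega -> 'rV[R]_M) (x0 v0 : 'rV[R]_M) (dt : R).

Lemma eulerE g n w : euler F sigma B x0 v0 dt g n w =
  euler_map (F g) (sigma g) dt (fun k => increment B dt k w) (x0 + g *: v0) n.
Proof. by elim: n => [//|n IH]; rewrite /= IH. Qed.

Lemma euler0E n w : euler F sigma B x0 v0 dt 0 n w =
  euler_map (F 0) (sigma 0) dt (fun k => increment B dt k w) x0 n.
Proof. by rewrite eulerE scale0r addr0. Qed.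

Lemma tangentE n w : (forall x, differentiable (sigma 0) x) ->
  tangent F dF sigma dsigma alpha B x0 v0 dt n w =
  damped_tangent (F 0) (dF 0) (sigma 0) (dsigma 0) dt x0 v0
    (fun k => alpha (k%:R * dt) w) (fun k => increment B dt k w) n.
Proof. by move=> ds; elim: n => [//|n IH]; rewrite /= IH euler0E diff_gradE. Qed.

End euler_identification.

Section centered_sums.
Context {R : realType} {d : measure_display} {T : measurableType d}.
Variable mu : {measure set T -> \bar R}.

Lemma integrable_sum_centered (I : finType) (f : I -> T -> R) :
  (forall i, mu.-integrable setT (EFin \o f i) /\ \int[mu]_w f i w = 0) ->
  mu.-integrable setT (EFin \o (fun w => \sum_i f i w)) /\ \int[mu]_w (\sum_i f i w) = 0.
Proof.
move=> fi.
elim: (index_enum I) => [|i s [IH1 IH2]].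
  have -> : (fun w => \sum_(i <- [::]) f i w) = cst 0 by apply/funext => w; rewrite big_nil.
  by split; [exact: integrable0|rewrite /Rintegral integral0].
have -> : (fun w => \sum_(j <- i :: s) f j w) = (fun w => f i w + \sum_(j <- s) f j w).
  by apply/funext => w; rewrite big_cons.
have [h1 h2] := fi i; split; last by rewrite RintegralD// h2 IH2 addr0.
rewrite (_ : EFin \o _ = (EFin \o f i) \+ (EFin \o (fun w => (\sum_(j <- s) f j w)%R)))%E//.
exact: integrableD.
Qed.

End centered_sums.

(** The integrability clauses give meaning to the expectations: [fine] would turn an infinite one
    into a default value. *)
Theorem mainTheorem2
  (R : realType) (d : measure_display) (Omega : measurableType d)
  (P : probability Omega R) (M : nat) (T : R) (T_gt0 : 0 < T)
  (B : R -> Omega -> 'rV[R]_M) (B_bm : standard_brownian_motion P B)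
  (gmin gmax : R) (gmin_lt0 : gmin < 0) (gmax_gt0 : 0 < gmax)
  (F dF : R -> 'rV[R]_M -> 'rV[R]_M)
  (sigma dsigma : R -> 'rV[R]_M -> R^o)
  (Phi : 'rV[R]_M -> R^o)
  (alpha : R -> Omega -> R)
  (L K sigma_star alpha_star L' C : R)
  (L_gt0 : 0 < L) (K_gt0 : 0 < K) (sigma_star_gt0 : 0 < sigma_star)
  (alpha_star_gt0 : 0 < alpha_star) (L'_gt0 : 0 < L') (C_gt0 : 0 < C)
  (F_diff : forall (g : R) (x : 'rV[R]_M), g \in `[gmin, gmax] -> differentiable (F g) x)
  (sigma_diff : forall (g : R) (x : 'rV[R]_M), g \in `[gmin, gmax] -> differentiable (sigma g) x)
  (Phi_diff : forall x : 'rV[R]_M, differentiable Phi x)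
  (dFE : forall (g : R) (x : 'rV[R]_M), g \in `[gmin, gmax] ->
    has_derivative_on `[gmin, gmax] (fun c => F c x) g (dF g x))
  (dsigmaE : forall (g : R) (x : 'rV[R]_M), g \in `[gmin, gmax] ->
    has_derivative_on `[gmin, gmax] (fun c => sigma c x) g (dsigma g x))
  (A1 : forall (g : R) (x y : 'rV[R]_M), g \in `[gmin, gmax] ->
    [/\ enorm (F g x - F g y) <= L * enorm (x - y),
        `|sigma g x - sigma g y| <= L * enorm (x - y),
        enorm (dF g x - dF g y) <= L * enorm (x - y)
      & `|dsigma g x - dsigma g y| <= L * enorm (x - y)])
  (A2 : forall (g : R) (x : 'rV[R]_M), g \in `[gmin, gmax] ->
    [/\ enorm (F g x) ^+ 2 <= K * (1 + enorm x ^+ 2),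
        `|sigma g x| ^+ 2 <= K * (1 + enorm x ^+ 2),
        enorm (dF g x) ^+ 2 <= K * (1 + enorm x ^+ 2)
      & `|dsigma g x| ^+ 2 <= K * (1 + enorm x ^+ 2)])
  (A3_adapted : adapted_on T (natural_filtration B) alpha)
  (A3_paths : {ae P, forall w,
    (forall t : R, t \in `[0, T] -> `|alpha t w| <= alpha_star) /\
    (forall s t : R, s \in `[0, T] -> t \in `[0, T] ->
      `|alpha t w - alpha s w| <= C * `|t - s|)})
  (A4 : forall (g : R) (x : 'rV[R]_M), g \in `[gmin, gmax] -> sigma_star <= `|sigma g x|)
  (A5 : forall x y : 'rV[R]_M,
    `|Phi x - Phi y| <= L' * enorm (x - y) /\
    enorm (grad Phi x - grad Phi y) <= L' * enorm (x - y))
  (N : nat) (N_ge1 : (1 <= N)%N) (x0 v0 : 'rV[R]_M) :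
  let dt := T / N%:R in
  let X := euler F sigma B x0 v0 dt in
  let v := tangent F dF sigma dsigma alpha B x0 v0 dt in
  let J : R -> R^o := fun g => fine 'E_P[fun w => Phi (X g N w)]%E in
  let rhs : Omega -> R := fun w =>
    dotp (grad Phi (X 0 N w)) (v N w) +
    Phi (X 0 N w) *
      \sum_(0 <= n < N)
        dotp ((sigma 0 (X 0 n w))^-1 *: increment B dt n w)
             (alpha (n%:R * dt) w *: v n w) in
  [/\ forall g : R, g \in `[gmin, gmax] ->
        P.-integrable setT (EFin \o (fun w => Phi (X g N w))),
      P.-integrable setT (EFin \o rhs),
      derivable J 0 1
    & (derive1 J 0)%:E = ('E_P[rhs])%E].
Proof.
move=> dt X v J rhs.
have dt0 : 0 < dt by rewrite divr_gt0// ltr0n.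
have Ndt k : (k <= N)%N -> k%:R * dt \in `[0, T].
  move=> kN; rewrite in_itv /= mulr_ge0 ?(ltW dt0)//= /dt mulrCA.
  rewrite ler_piMr ?(ltW T_gt0)// ler_pdivrMr ?ltr0n// mul1r ler_nat //.
have I0 : (0 : R) \in `[gmin, gmax] by rewrite in_itv /= !ltW.
(* One constant for all sup-norm estimates: the summands serve the Lipschitz bounds (A1), the linear
   growth from (A2) and the Lipschitz bound on [Phi]. The factors [M%:R] come from [enorm_le]. *)
pose Lc := L * M%:R + (1 + K) * (1 + M%:R) + L' * M%:R.
have M0 : (0 : R) <= M%:R by [].
have P1 : 0 <= L * M%:R by rewrite mulr_ge0// ltW.
have P2 : 0 <= (1 + K) * (1 + M%:R) by rewrite mulr_ge0// addr_ge0// ltW.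
have P3 : 0 <= L' * M%:R by rewrite mulr_ge0// ltW.
have Lc0 : 0 <= Lc by rewrite /Lc !addr_ge0.
have Lc1 : L * M%:R <= Lc by rewrite /Lc -addrA lerDl addr_ge0.
have Lc2 : (1 + K) * (1 + M%:R) <= Lc by rewrite /Lc addrAC lerDr addr_ge0.
have Lc3 : L' * M%:R <= Lc by rewrite /Lc lerDr addr_ge0.
have LLc (V : normedModType R) (u : V) (x y : 'rV[R]_M) : `|u| <= L * enorm (x - y) ->
    `|u| <= Lc * `|x - y|.
  move=> h; apply: le_trans h _.
  apply: (@le_trans _ _ (L * M%:R * `|x - y|)).
    by rewrite -mulrA; apply: ler_wpM2l; [exact: ltW|exact: enorm_le].
  exact: ler_wpM2r.
have L'Lc (V : normedModType R) (u : V) (x y : 'rV[R]_M) : `|u| <= L' * enorm (x - y) ->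
    `|u| <= Lc * `|x - y|.
  move=> h; apply: le_trans h _.
  apply: (@le_trans _ _ (L' * M%:R * `|x - y|)).
    by rewrite -mulrA; apply: ler_wpM2l; [exact: ltW|exact: enorm_le].
  exact: ler_wpM2r.
have KLc (V : normedModType R) (u : V) (x : 'rV[R]_M) (e : R) :
    `|u| <= e -> 0 <= e -> e ^+ 2 <= K * (1 + enorm x ^+ 2) -> `|u| <= Lc * (1 + `|x|).
  move=> ue e0 eK; apply: le_trans ue _.
  have ex0 := enorm_ge0 x; have ex := enorm_le x.
  have x0' : 0 <= `|x| by [].
  (* Squares are compared factor by factor: [K <= (1 + K) ^+ 2] and [1 + e ^+ 2 <= (1 + e) ^+ 2] for
     [e = enorm x]. *)
  apply: (@le_trans _ _ ((1 + K) * (1 + enorm x))).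
    have q0 : 0 <= (1 + K) * (1 + enorm x) by rewrite mulr_ge0// addr_ge0// ltW.
    rewrite -(@ler_pXn2r _ 2)// ?nnegrE//.
    apply: le_trans eK _; rewrite exprMn; apply: ler_pM.
    - exact: ltW.
    - by rewrite addr_ge0 ?sqr_ge0.
    - by rewrite expr2; nra.
    - by rewrite !expr2; nra.
  apply: (@le_trans _ _ ((1 + K) * (1 + M%:R) * (1 + `|x|))).
    rewrite -mulrA; apply: ler_wpM2l; first by rewrite addr_ge0// ltW.
    by nra.
  by apply: ler_wpM2r => //; rewrite addr_ge0.
have FL g x y : g \in `[gmin, gmax] -> `|F g x - F g y| <= Lc * `|x - y|.
  move=> gI; have [h _ _ _] := A1 g x y gI.
  by apply: LLc; apply: le_trans h; exact: rV_normr_enorm.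
have sL g x y : g \in `[gmin, gmax] -> `|sigma g x - sigma g y| <= Lc * `|x - y|.
  by move=> gI; have [_ h _ _] := A1 g x y gI; exact: (LLc R^o).
have dFL g x y : g \in `[gmin, gmax] -> `|dF g x - dF g y| <= Lc * `|x - y|.
  move=> gI; have [_ _ h _] := A1 g x y gI.
  by apply: LLc; apply: le_trans h; exact: rV_normr_enorm.
have dsL g x y : g \in `[gmin, gmax] -> `|dsigma g x - dsigma g y| <= Lc * `|x - y|.
  by move=> gI; have [_ _ _ h] := A1 g x y gI; exact: (LLc R^o).
have dFK g x : g \in `[gmin, gmax] -> `|dF g x| <= Lc * (1 + `|x|).
  move=> gI; have [_ _ h _] := A2 g x gI.
  by apply: (KLc _ _ _ (enorm (dF g x))) => //; [exact: rV_normr_enorm|exact: enorm_ge0].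
have dsK g x : g \in `[gmin, gmax] -> `|dsigma g x| <= Lc * (1 + `|x|).
  by move=> gI; have [_ _ _ h] := A2 g x gI; apply: (KLc R^o _ _ `|dsigma g x|).
have PhiL x y : `|Phi x - Phi y| <= Lc * `|x - y|.
  by have [h _] := A5 x y; exact: (L'Lc R^o).
(* The first two bounds keep [|h| < r] inside the parameter interval; the bound 1 is required by
   [euler_difference_bound]. *)
pose r : R := Num.min (Num.min (- gmin) gmax) 1.
have r0 : 0 < r by rewrite /r !lt_min oppr_gt0 gmin_lt0 gmax_gt0 ltr01.
have r1 : r <= 1 by rewrite /r ge_min lexx orbT.
have rmin : r <= - gmin by rewrite /r !ge_min lexx.
have rmax : r <= gmax by rewrite /r !ge_min lexx !orbT.
have fF : smooth_family F (dF 0) r Lc.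
  exact (smooth_family_intro (@mean_value_bound_rV R M) gmin_lt0 gmax_gt0 r0 rmin rmax F_diff dFE FL dFL dFK).
have fs : smooth_family sigma (dsigma 0) r Lc.
  exact (smooth_family_intro (@mean_value_bound_real R) gmin_lt0 gmax_gt0 r0 rmin rmax sigma_diff dsigmaE sL dsL dsK).
have D0 x : differentiable (F 0) x by exact: F_diff.
have Ds0 x : differentiable (sigma 0) x by exact: sigma_diff.
have fF0 : smooth_family (fun=> F 0) (fun=> 0) 1 Lc.
  by apply: smooth_family_cst => // x y; exact: FL.
have fs0 : smooth_family (fun=> sigma 0) (fun=> 0) 1 Lc.
  by apply: smooth_family_cst => // x y; exact: sL.
have lip_cont (V : normedModType R) (f : 'rV[R]_M -> V) := @lipschitz_continuous R _ V f Lc Lc0.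
pose A : set Omega := [set w | forall t : R, t \in `[0, T] -> `|alpha t w| <= alpha_star].
have aeA : {ae P, forall w, A w} by apply: filterS A3_paths => w [].
pose xi k w := increment B dt k w.
pose S := noise_size B dt N.
have S0 w : 0 <= S w by exact: noise_size_ge0.
have xiS k w : (k < N)%N -> `|xi k w| <= S w by move=> kN; exact: increment_le_noise_size.
have mxi k : (k < N)%N -> measurable_rV (xi k) by move=> _; exact: (measurable_increment B_bm dt0).
have mX g n : g \in `[gmin, gmax] -> (n <= N)%N -> measurable_rV (X g n).
  move=> gI nN; have -> : X g n = fun w => euler_map (F g) (sigma g) dt (xi ^~ w) (x0 + g *: v0) n.
    by apply/funext => w; rewrite /X eulerE.
  by apply: (measurable_euler_map _ _ mxi) => //; apply: lip_cont => x y; [exact: FL|exact: sL].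
have cPhi : continuous Phi by move=> x; exact: differentiable_continuous.
have mPhi g : g \in `[gmin, gmax] ->
    measurable_fun setT (fun w => Phi (X g N w) : measurableTypeR R).
  by move=> gI; apply: measurable_fun_comp_rV => //; exact: mX.
have Phi_growth x : `|Phi x| <= `|Phi 0| + Lc * `|x| by exact: (lipschitz_growth PhiL).
have bX g n : g \in `[gmin, gmax] -> (n <= N)%N -> exp_bounded A S (fun w => `|X g n w|).
  move=> gI nN.
  have -> : (fun w => `|X g n w|) =
      fun w => `|euler_map (F g) (sigma g) dt (xi ^~ w) (x0 + g *: v0) n|.
    by apply/funext => w; rewrite /X eulerE.
  apply: (@exp_bounded_euler_map _ _ _ A S S0 dt xi N xiS _ _
    (`|F g 0| + `|sigma g 0|) Lc) => //.
  - move=> x; have h := lipschitz_growth (fun x y => FL g x y gI) x; apply: le_trans h _.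
    by rewrite lerD2r lerDl.
  - move=> x; have h := lipschitz_growth (fun x y => sL g x y gI) x; apply: le_trans h _.
    by rewrite lerD2r lerDr.
have bPhi g : g \in `[gmin, gmax] -> exp_bounded A S (fun w => Phi (X g N w)).
  move=> gI; have h := exp_bounded_linear_growth S0 (normr_ge0 (Phi 0)) Lc0 Phi_growth (bX g N gI (leqnn N)).
  by apply: (exp_bounded_le h) => w _; rewrite normr_id.
have int_Phi g : g \in `[gmin, gmax] -> P.-integrable setT (EFin \o (fun w => Phi (X g N w))).
  by move=> gI; exact: (integrable_exp_bounded B_bm dt0 aeA (mPhi g gI) (bPhi g gI)).
have rI h : `|h| < r -> h \in `[gmin, gmax].
  rewrite ltr_norml in_itv /= => /andP[h1 h2]; apply/andP; split; apply: ltW.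
    by apply: le_lt_trans h1; rewrite lerNr.
  exact: lt_le_trans h2 rmax.
pose u w := tangent_map (F 0) (dF 0) (sigma 0) (dsigma 0) dt (xi ^~ w) (fun=> 0) x0 v0 N.
pose f' w : R^o := 'd Phi (X 0 N w) (u w).
have [G G0 [bG GX]] := @euler_difference_bound _ _ _ A S S0 dt xi N xiS _ _ _ _ r Lc
  r0 r1 Lc0 fF fs x0 v0 (fun=> 0) N (leqnn N).
have XE h w : X h N w =
    euler_map (F h) (sigma h) dt (fun k => xi k w + h *: 0) (x0 + h *: v0) N.
  rewrite /X eulerE; congr (euler_map _ _ _ _ _ _).
  by apply/funext => k; rewrite scaler0 addr0.
have X0E w : X 0 N w = euler_map (F 0) (sigma 0) dt (xi ^~ w) x0 N by rewrite /X euler0E.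
have bLG : exp_bounded A S (fun w => Lc * G w) by exact: exp_boundedZ.
have PhiG h w : A w -> `|h| < r -> `|Phi (X h N w) - Phi (X 0 N w)| <= `|h| * (Lc * G w).
  move=> Aw hr; apply: le_trans (PhiL _ _) _; rewrite mulrCA ler_wpM2l//.
  by rewrite XE X0E; exact: GX.
have dPhiX w : curve_deriv (fun h => Phi (X h N w) : R^o) (Phi (X 0 N w) : R^o) (f' w).
  have h1 : curve_deriv (fun h => X h N w) (X 0 N w) (u w).
    rewrite X0E (_ : (fun h => X h N w) = fun h => euler_map (F h) (sigma h) dt
      (fun k => xi k w + h *: 0) (x0 + h *: v0) N); last by apply/funext => h; exact: XE.
    exact: (@euler_map_curve_deriv R M F (dF 0) sigma (dsigma 0) r Lc r0
      fF fs dt x0 v0 (fun=> 0) (xi ^~ w) N).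
  exact: (curve_deriv_comp (Phi_diff _) h1).
have [_ if' cJ] := @curve_deriv_expectation_exp _ _ _ P M B B_bm dt dt0 N A aeA r
  (fun h w => Phi (X h N w)) (fun w => Phi (X 0 N w)) f' (fun w => Lc * G w) r0
  (fun h hr => mPhi h (rI h hr)) (mPhi 0 I0) (bPhi 0 I0) bLG PhiG dPhiX.
have JE g : J g = \int[P]_w Phi (X g N w).
  by rewrite /J unlock /Rintegral.
pose a k w := alpha (k%:R * dt) w.
have aA k w : (k < N)%N -> A w -> `|a k w| <= alpha_star.
  by move=> kN; apply; apply: Ndt; exact: ltnW.
have a_adapted k (U : set (measurableTypeR R)) : (k < N)%N -> measurable U ->
    natural_filtration B (k%:R * dt) (a k @^-1` U).
  move=> kN mU; apply: (A3_adapted _ (Ndt k (ltnW kN))); exists U => //.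
  by rewrite setTI.
have cdF : continuous (dF 0) by apply: lip_cont => x y; exact: dFL.
have cds : continuous (dsigma 0) by apply: lip_cont => x y; exact: dsL.
pose wt w (p : 'I_N * 'I_M) :=
  damping_weight (F 0) (dF 0) (sigma 0) (dsigma 0) dt x0 v0 (a ^~ w) (xi ^~ w) p.1 p.2.
pose D w (p : 'I_N * 'I_M) :=
  tangent_map (F 0) (fun=> 0) (sigma 0) (fun=> 0) dt (xi ^~ w) (unit_shift p.1 p.2) x0 0 N.
have ibp (p : 'I_N * 'I_M) := @weight_ibp _ _ _ P M B B_bm dt dt0 N A aeA (F 0) (dF 0) (sigma 0) (dsigma 0)
  Lc Lc0 fF0 fs0 cdF cds (fun x => dFK 0 x I0) (fun x => dsK 0 x I0) sigma_star sigma_star_gt0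
  (fun x => A4 0 x I0) Phi Phi_diff PhiL x0 v0 a alpha_star aA a_adapted p.1 p.2 (ltn_ord p.1).
(* Each [c p] is the gap between the two sides of [weight_ibp], hence centered. By [rhsE] below,
   [rhs] differs from the pathwise derivative [f'] exactly by their sum. *)
pose c (p : 'I_N * 'I_M) w : R :=
  Phi (X 0 N w) * wt w p * (xi p.1 w 0 p.2 / dt) - wt w p * 'd Phi (X 0 N w) (D w p).
have c0 p : P.-integrable setT (EFin \o c p) /\ \int[P]_w c p w = 0.
  have [i1 i2 i12] := ibp p.
  have cE : c p = (fun w => Phi (euler_map (F 0) (sigma 0) dt (xi ^~ w) x0 N) * wt w p *
      (xi p.1 w 0 p.2 / dt) -
      wt w p * 'd Phi (euler_map (F 0) (sigma 0) dt (xi ^~ w) x0 N) (D w p)).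
    by apply/funext => w; rewrite /c X0E.
  rewrite cE; split; first exact (integrableB measurableT i2 i1).
  transitivity (\int[P]_w (Phi (euler_map (F 0) (sigma 0) dt (xi ^~ w) x0 N) * wt w p *
      (xi p.1 w 0 p.2 / dt)) -
    \int[P]_w (wt w p * 'd Phi (euler_map (F 0) (sigma 0) dt (xi ^~ w) x0 N) (D w p))).
    exact (RintegralB measurableT i2 i1).
  by apply/eqP; rewrite subr_eq0; apply/eqP; exact (esym i12).
have [ic Ic] := integrable_sum_centered c0.
have s_neq0 x : sigma 0 x != 0.
  by rewrite -normr_gt0; apply: lt_le_trans sigma_star_gt0 _; exact: A4.
have vE n w : v n w = damped_tangent (F 0) (dF 0) (sigma 0) (dsigma 0) dt x0 v0 (a ^~ w) (xi ^~ w) n.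
  exact: tangentE.
have uE w : u w = v N w + \sum_p wt w p *: D w p.
  by rewrite vE; exact: tangent_decomposition.
have rhsE w : rhs w = f' w + \sum_p c p w.
  rewrite /f' uE linearD linear_sum /= -addrA -big_split /=.
  rewrite /rhs -diff_gradE//; congr (_ + _).
  rewrite big_mkord mulr_sumr.
  rewrite [RHS](eq_bigr (fun p : 'I_N * 'I_M =>
    Phi (X 0 N w) * (wt w p * (xi p.1 w 0 p.2 / dt)))); last first.
    move=> p _; rewrite linearZ /= /c [RHS]mulrA.
    by rewrite -[X in X + _ = _]/(wt w p * 'd Phi (X 0 N w) (D w p)) addrC subrK.
  rewrite -(pair_bigA _ (fun (n : 'I_N) (j : 'I_M) =>
    Phi (X 0 N w) * (wt w (n, j) * (xi n w 0 j / dt)))) /=.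
  apply: eq_bigr => n _; rewrite -mulr_sumr; congr (_ * _).
  (* The [dt] inside the weight cancels the division by the variance [dt]. *)
  rewrite dotpZl dotpZr /dotp !mulr_sumr; apply: eq_bigr => j _.
  rewrite /wt /damping_weight /= -vE -/(xi n w) /X euler0E /a; field.
  by rewrite s_neq0 gt_eqF.
have irhs : P.-integrable setT (EFin \o rhs).
  rewrite (_ : EFin \o rhs = (EFin \o f') \+ (EFin \o (fun w => (\sum_p c p w)%R)))%E.
    exact: integrableD.
  by apply/funext => w; rewrite /= rhsE.
have Erhs : \int[P]_w rhs w = \int[P]_w f' w.
  by under eq_Rintegral do rewrite rhsE; rewrite RintegralD// Ic addr0.
have cJ' : curve_deriv J (J 0) (\int[P]_w rhs w : R^o).
  rewrite Erhs JE (_ : J = fun g => \int[P]_w Phi (X g N w)); first exact: cJ.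
  by apply/funext.
split=> //.
- apply/cvg_ex; exists (\int[P]_w rhs w).
  apply: near_cvg cJ'; apply: nearW => h /=.
  by rewrite addr0 [h *: 1]mulr1.
- rewrite unlock -[RHS]fineK; last exact: integrable_fin_num.
  congr EFin; rewrite /derive1; apply/cvg_lim => //.
  by apply: near_cvg cJ'; apply: nearW => h /=; rewrite addr0.
Qed.
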